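(* The ordinary generating function $F(x)=\sum_{n\ge 0}|\mathfrak D^1_{2n}(2413,3142)|\,x^n$ is given by \[ F(x)=\frac{3-\sqrt{1-8x}}{2(1+x)}=\frac{1}{3}C\!\left(\frac{2(1+x)}{9}\right)=\frac{1+2xC(2x)}{1+x}=\frac{1}{1-xC(2x)}, \] and consequently, for every $n\ge 0$, \[ |\mathfrak D^1_{2n}(2413,3142)|=(-1)^n+\sum_{k=1}^{n}(-1)^{n-k}2^{k}C_{k-1}=\sum_{k=0}^{n-1}\frac{n-k}{n+k}\binom{n+k}{n}2^k+\delta_{n=0}, \] where $\delta_{n=0}$ is $1$ if $n=0$ and $0$ otherwise.
   Context: A Dumont permutation of the first kind of length $2n$ is a permutation $\pi\in\mathfrak S_{2n}$ such that for every $i=1,\dots,2n$: if $\pi(i)$ is even then $i<2n$ and $\pi(i)>\pi(i+1)$; if $\pi(i)$ is odd then $i=2n$ or $\pi(i)<\pi(i+1)$. $\mathfrak D^1_{2n}$ denotes the set of these ($\mathfrak D^1_0$ consists of the empty permutation). A permutation $\sigma$ contains a pattern $\tau\in\mathfrak S_k$ if some subsequence $(\sigma(i_1),\dots,\sigma(i_k))$, $i_1<\dots<i_k$, is order-isomorphic to $\tau$; otherwise $\sigma$ avoids $\tau$. $\mathfrak D^1_{2n}(T)$ denotes the set of permutations in $\mathfrak D^1_{2n}$ avoiding every pattern in $T$. $C_m=\frac{1}{m+1}\binom{2m}{m}$ is the $m$th Catalan number and $C(x)=\frac{1-\sqrt{1-4x}}{2x}=\sum_{m\ge0}C_mx^m$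 its ordinary generating function.
   Formalization: The form F(x) = (1/3)C(2(1+x)/9) is false (at x = 0 it gives 1/2, while F(0) = 1); it is corrected to F(x) = (2/3)C(2(1+x)/9). The generating function identities are stated for real |x| < 1/8. *)

(* Defs.v *)
From HB Require Import structures.
From mathcomp Require Import all_boot all_order all_algebra all_fingroup.
From mathcomp Require Import all_classical all_reals all_analysis.
Set Implicit Arguments. Unset Strict Implicit. Unset Printing Implicit Defensive.
Import Order.TTheory GRing.Theory Num.Theory.

Definition oneline m (s : 'S_m) : seq nat := [seq (val (s i)).+1 | i <- enum 'I_m].

(* Dumont permutation of the first kind (w is the one-line word, values 1..2n):
   if w(i) even then i < 2n and w(i) > w(i+1);
   if w(i) odd then i = 2n or w(i) < w(i+1).  (0-based positions below.) *)
Definition dumont1_word (w : seq nat) : bool :=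
  [forall i : 'I_(size w),
     let a := nth 0 w i in
     if ~~ odd a then (i.+1 < size w) && (nth 0 w i.+1 < a)
     else (i.+1 == size w) || (a < nth 0 w i.+1)].

Definition order_iso (u t : seq nat) : bool :=
  (size u == size t) &&
  [forall i : 'I_(size u), forall j : 'I_(size u),
     (nth 0 u i < nth 0 u j) == (nth 0 t i < nth 0 t j)].

Definition contains (w t : seq nat) : bool :=
  [exists m : (size w).-tuple bool, order_iso (mask m w) t].

Definition avoids_all (w : seq nat) (T : seq (seq nat)) : bool :=
  all (fun t => ~~ contains w t) T.

Definition D1_2413_3142 (n : nat) : nat :=
  #|[set s : 'S_(n.*2) | dumont1_word (oneline s)
        && avoids_all (oneline s) [:: [:: 2; 4; 1; 3]; [:: 3; 1; 4; 2]]]|.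

Definition catalan (m : nat) : nat := 'C(m.*2, m) %/ m.+1.

(* Catalan generating function C(y) = (1 - sqrt(1-4y))/(2y), with C(0) = 1
   (its value as a sum of the power series at y = 0). *)
Local Open Scope ring_scope.
Definition Cgf (R : realType) (y : R) : R :=
  if y == 0 then 1 else (1 - Num.sqrt (1 - 4 * y)) / (2 * y).

(* Main.v *)
(* Separable permutations of size at least 2 are either direct sums or skew sums. Let D
   and P be the generating functions of all, respectively of the skew-decomposable,
   Dumont permutations considered here; S = D - 1 - P then counts the direct sums.
   The first component of a direct sum has even length and is again Dumont, so
   D = 1 + P D. Splitting a skew sum before its last component and complementing the
   upper part, which exchanges parities as well as ascents and descents, gives
   P = (D - 1) S + x D^2. Together these yield P = x + 2 P^2 and D (1 + x) = 1 + 2 P,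
   that is P = x C(2x). *)
Require Import Defs.
From HB Require Import structures.
From mathcomp Require Import all_boot all_order all_algebra all_fingroup.
From mathcomp Require Import all_classical all_reals all_analysis.
From mathcomp Require Import zify ring lra.
Import Order.TTheory GRing.Theory Num.Theory.
Import numFieldNormedType.Exports.
Set Implicit Arguments. Unset Strict Implicit. Unset Printing Implicit Defensive.

(** The two recursions differ because of their junctions. At an ascent the left part must end in an
    odd letter, as Dumont words do, so direct sums factor into Dumont words. At a descent it must
    end in an even letter; the upper part of a skew sum thus belongs to a second class, which
    complementation by an odd constant carries back to Dumont words. Unique factorisation then makes
    each recursion a convolution of counts. Power series are replaced by polynomials truncated at
    degree N, and equations by congruences modulo X^N with an explicit multiple of X^N. The
    coefficients of P come from a linear differential equation instead of a square root; both sums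
    for the counts then follow by induction from d(n+1) + d(n) = 2 p(n+1). For the analytic
    statement, the truncations of P nearly solve the quadratic equation when |x| < 1/8, where 1/8 is
    the zero of its discriminant 1 - 8x, and their bound 1/4, the value P(1/8), selects the root. *)

Lemma size_decomp (T I U V : eqType) (L : seq T) (K : seq I)
    (LU : I -> seq U) (LV : I -> seq V) (f : I -> U -> V -> T) :
  uniq L -> uniq K -> (forall k, uniq (LU k)) -> (forall k, uniq (LV k)) ->
  (forall k u v, k \in K -> u \in LU k -> v \in LV k -> f k u v \in L) ->
  (forall w, w \in L ->
     exists k u v, [/\ k \in K, u \in LU k, v \in LV k & w = f k u v]) ->
  (forall k u v k' u' v', k \in K -> u \in LU k -> v \in LV k ->
     k' \in K -> u' \in LU k' -> v' \in LV k' ->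
     f k u v = f k' u' v' -> [/\ k = k', u = u' & v = v']) ->
  size L = \sum_(k <- K) size (LU k) * size (LV k).
Proof.
move=> uL uK uU uV fL Lf inj_f.
pose F k := [seq f k u v | u <- LU k, v <- LV k].
have memF k w : w \in F k ->
    exists u v, [/\ u \in LU k, v \in LV k & w = f k u v].
  by case/allpairsP=> -[u v] /= [? ? ->]; exists u, v.
suff /perm_size -> : perm_eq L (flatten [seq F k | k <- K]).
  rewrite size_flatten /shape -map_comp sumnE big_map.
  by apply: eq_bigr => k _; rewrite /= size_allpairs.
apply: (uniq_perm uL); last first.
  move=> w; apply/idP/flatten_mapP.
    move=> /Lf [k [u [v [kK uk vk ->]]]]; exists k => //.
    by apply/allpairsP; exists (u, v).
  by case=> k kK /memF [u [v [uk vk ->]]]; apply: fL.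
(* The trivial inclusion separates two roles of [K]: the list being flattened shrinks in the
   induction, while the hypotheses on [f] keep referring to the original one. *)
have: {subset K <= K} by [].
elim: {1 2 4}K uK => //= k K' IH /andP[kK' uK'] sub.
rewrite cat_uniq IH ?andbT //; last by move=> x xK'; rewrite sub // inE xK' orbT.
have kK : k \in K by rewrite sub ?mem_head.
apply/andP; split.
  apply: allpairs_uniq => // -[u v] [u' v'].
  case/allpairsP=> -[a b] /= [? ? [-> ->]]; case/allpairsP=> -[c d] /= [? ? [-> ->]].
  by case/(inj_f _ _ _ _ _ _ kK _ _ kK) => // _ -> ->.
apply/hasPn => w /flatten_mapP [k' k'K' /memF [u [v [uk vk ->]]]].
apply/negP => /memF [u' [v' [uk' vk' E]]].
have k'K : k' \in K by rewrite sub // inE k'K' orbT.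
case: (inj_f _ _ _ _ _ _ k'K uk vk kK uk' vk' E) => kk _ _.
by rewrite -kk k'K' in kK'.
Qed.

(** * Separable words *)

(** The letters are named by rank under [r], so the two words are 2413 and 3142. Reversing [r]
    exchanges these patterns, so that one argument serves direct and skew sums alike. *)
Definition pattern_free (r : rel nat) (w : seq nat) : Prop :=
  forall a b c d, r a b -> r b c -> r c d ->
    ~~ subseq [:: b; d; a; c] w /\ ~~ subseq [:: c; a; d; b] w.

Local Notation conv r := (fun x y => r y x).

Lemma pattern_free_conv r w : pattern_free r w -> pattern_free (conv r) w.
Proof. by move=> fw a b c d rab rbc rcd; case: (fw d c b a) => // ? ?; split. Qed.

Lemma pattern_free_subseq r v w :
  subseq v w -> pattern_free r w -> pattern_free r v.
Proof.
move=> vw fw a b c d rab rbc rcd; have [n1 n2] := fw _ _ _ _ rab rbc rcd.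
split; [apply: contra n1|apply: contra n2] => h; exact: subseq_trans h vw.
Qed.

Lemma subseq_mapP (f : nat -> nat) s w :
  subseq s (map f w) -> exists2 t, subseq t w & s = map f t.
Proof.
case/subseqP=> m sm ->; exists (mask m w); last by rewrite map_mask.
exact: mask_subseq.
Qed.

Lemma pattern_free_map (r r' : rel nat) (f : nat -> nat) w :
  {in w &, forall x y, r (f x) (f y) -> r' x y} ->
  pattern_free r' w -> pattern_free r (map f w).
Proof.
move=> rf fw a b c d rab rbc rcd.
split; apply/negP => /subseq_mapP [[|x [|y [|z [|t [|? ?]]]]] //= sw].
  case=> eb ed ea ec; have sub := mem_subseq sw.
  have [] := fw z x t y; rewrite ?sw //; apply: rf;
    rewrite ?sub ?inE ?eqxx ?orbT -?ea -?eb -?ec -?ed //.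
case=> ec ea ed eb; have sub := mem_subseq sw.
have [] := fw y t x z; rewrite ?sw //; apply: rf;
    rewrite ?sub ?inE ?eqxx ?orbT -?ea -?eb -?ec -?ed //.
Qed.

Lemma subseq_catP (s A B : seq nat) :
  subseq s (A ++ B) -> exists s1 s2, [/\ s = s1 ++ s2, subseq s1 A & subseq s2 B].
Proof.
elim: A s => [|x A IH] s; first by exists [::], s.
case: s => [|y s] /=; first by exists [::], [::]; rewrite sub0seq.
case: eqP => [->|_] /IH [s1 [s2 [E sA sB]]].
  by exists (x :: s1), s2; rewrite E /= eqxx.
exists s1, s2; split=> //; exact: subseq_trans sA (subseq_cons _ _).
Qed.

Definition asym (r : rel nat) := forall x y, r x y -> ~~ r y x.

(** Neither pattern is a direct sum: every proper cut leaves a letter of the prefix above one of the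
    suffix. An occurrence in [A ++ B] therefore lies in one part. *)
Lemma pattern_free_cat r A B : asym r ->
  allrel r A B -> pattern_free r A -> pattern_free r B -> pattern_free r (A ++ B).
Proof.
move=> asr AB fA fB a b c d rab rbc rcd.
have [/negbTE nA1 /negbTE nA2] := fA _ _ _ _ rab rbc rcd.
have [/negbTE nB1 /negbTE nB2] := fB _ _ _ _ rab rbc rcd.
have cross x y s1 s2 : subseq s1 A -> subseq s2 B -> r y x ->
    ~~ ((x \in s1) && (y \in s2)).
  move=> /mem_subseq h1 /mem_subseq h2 ryx; apply/negP => /andP[/h1 xA /h2 yB].
  by move: (asr _ _ (allrelP AB _ _ xA yB)); rewrite ryx.
split; apply/negP => /subseq_catP [s1 [s2 [E sA sB]]].
  (* In 2413 the first two cuts separate 2 from 1 and the last one separates 4 from 3; in 3142 every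
     cut separates 3 from 2. *)
  have := cross _ _ _ _ sA sB rab; have := cross _ _ _ _ sA sB rcd.
  case: s1 E sA sB => [|x [|y [|z [|t [|? ?]]]]] //=.
  - by move=> <-; rewrite nB1.
  - by case=> <- <- _ _; rewrite !inE !eqxx ?orbT.
  - by case=> <- <- <- _ _; rewrite !inE !eqxx ?orbT.
  - by case=> <- <- <- <- _ _; rewrite !inE !eqxx ?orbT.
  - by case=> <- <- <- <- _; rewrite nA1.
have := cross _ _ _ _ sA sB rbc.
case: s1 E sA sB => [|x [|y [|z [|t [|? ?]]]]] //=.
- by move=> <-; rewrite nB2.
- by case=> <- <- _ _; rewrite !inE !eqxx ?orbT.
- by case=> <- <- <- _ _; rewrite !inE !eqxx ?orbT.
- by case=> <- <- <- <- _ _; rewrite !inE !eqxx ?orbT.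
- by case=> <- <- <- <- _; rewrite nA2.
Qed.

Definition splits (r : rel nat) (w : seq nat) : bool :=
  has (fun i => allrel r (take i w) (drop i w)) (iota 1 (size w).-1).

Lemma splitsP r w : reflect
  (exists A B, [/\ w = A ++ B, A != [::], B != [::] & allrel r A B]) (splits r w).
Proof.
have aux (j m : nat) : 0 < j -> j < 1 + m.-1 -> j < m /\ m - j != 0 by lia.
apply: (iffP hasP) => [[i]|[A [B [-> A0 B0 AB]]]].
  rewrite mem_iota => /andP[i0 iw] h; exists (take i w), (drop i w).
  have [iw' siw] := aux _ _ i0 iw.
  by rewrite cat_take_drop h -!size_eq0 size_take size_drop iw' -lt0n i0 siw.
exists (size A); last by rewrite take_size_cat ?drop_size_cat.
have aux2 (a b : nat) : a != 0 -> b != 0 -> 0 < a < 1 + (a + b).-1 by lia.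
by rewrite mem_iota size_cat aux2 ?size_eq0.
Qed.

Lemma last_block r w : w != [::] ->
  exists A B, [/\ w = A ++ B, B != [::], allrel r A B & ~~ splits r B].
Proof.
move: {2}(size w) (leqnn (size w)) => n.
elim: n w => [|n IH] w; first by rewrite leqn0 size_eq0 => ->.
move=> sw w0; have [/splitsP [A [B [E A0 B0 AB]]]|nw] := boolP (splits r w); last first.
  by exists [::], w; split.
have [|A1 [B1 [EB B10 AB1 nB1]]] := IH B _ B0.
  by move: sw A0; rewrite E size_cat -size_eq0; lia.
exists (A ++ A1), B1; split=> //; first by rewrite E EB catA.
rewrite allrel_catl AB1 andbT; apply/allrelP => x y xA yB.
by apply: (allrelP AB) => //; rewrite EB mem_cat yB orbT.
Qed.

Lemma first_block r w : w != [::] ->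
  exists A B, [/\ w = A ++ B, A != [::], allrel r A B & ~~ splits r A].
Proof.
move: {2}(size w) (leqnn (size w)) => n.
elim: n w => [|n IH] w; first by rewrite leqn0 size_eq0 => ->.
move=> sw w0; have [/splitsP [A [B [E A0 B0 AB]]]|nw] := boolP (splits r w); last first.
  by exists w, [::]; rewrite cats0 allrel0r.
have [|A1 [B1 [EA A10 AB1 nA1]]] := IH A _ A0.
  by move: sw B0; rewrite E size_cat -size_eq0; lia.
exists A1, (B1 ++ B); split=> //; first by rewrite E EA catA.
rewrite allrel_catr AB1; apply/allrelP => x y xA yB.
by apply: (allrelP AB) => //; rewrite EA mem_cat xA.
Qed.

(** If the cuts differed, the letters between them, followed by the shorter last block, would be a
    splitting of the longer one. *)
Lemma last_block_inj r A B A' B' : A ++ B = A' ++ B' -> B != [::] -> B' != [::] ->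
  allrel r A B -> allrel r A' B' -> ~~ splits r B -> ~~ splits r B' ->
  A = A' /\ B = B'.
Proof.
have main X Y X' Y' : size X <= size X' -> X ++ Y = X' ++ Y' -> Y' != [::] ->
    allrel r X' Y' -> ~~ splits r Y -> X = X' /\ Y = Y'.
  move=> le E Y0 XY; rewrite -(cat_take_drop (size X) X') in E XY *.
  rewrite -catA in E.
  have sz : size X = size (take (size X) X').
    by rewrite size_take; case: ifP => ?; lia.
  have [EX EY] : X = take (size X) X' /\ Y = drop (size X) X' ++ Y'.
    by move/eqP: E; rewrite eqseq_cat // => /andP[/eqP ? /eqP ?].
  have [D0|D0] := eqVneq (drop (size X) X') [::].
    by rewrite -EX D0 cats0 EY D0.
  case/splitsP; exists (drop (size X) X'), Y'; split=> //.
  by move: XY; rewrite allrel_catl => /andP[].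
move=> E B0 B0' AB AB' nB nB'; case/orP: (leq_total (size A) (size A')) => le.
  exact: main.
by have [-> ->] := main _ _ _ _ le (esym E) B0 AB nB'.
Qed.

Lemma first_block_inj r A B A' B' : A ++ B = A' ++ B' -> A != [::] -> A' != [::] ->
  allrel r A B -> allrel r A' B' -> ~~ splits r A -> ~~ splits r A' ->
  A = A' /\ B = B'.
Proof.
have main X Y X' Y' : size X <= size X' -> X ++ Y = X' ++ Y' -> X != [::] ->
    allrel r X Y -> ~~ splits r X' -> X = X' /\ Y = Y'.
  move=> le E X0 XY; rewrite -(cat_take_drop (size X) X') in E *.
  rewrite -catA in E.
  have sz : size X = size (take (size X) X').
    by rewrite size_take; case: ifP => ?; lia.
  have [EX EY] : X = take (size X) X' /\ Y = drop (size X) X' ++ Y'.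
    by move/eqP: E; rewrite eqseq_cat // => /andP[/eqP ? /eqP ?].
  have [D0|D0] := eqVneq (drop (size X) X') [::].
    by rewrite -EX D0 cats0 EY D0.
  case/splitsP; exists X, (drop (size X) X'); rewrite -EX; split=> //.
  by move: XY; rewrite EY allrel_catr => /andP[].
move=> E A0 A0' AB AB' nA nA'; case/orP: (leq_total (size A) (size A')) => le.
  exact: main.
by have [-> ->] := main _ _ _ _ le (esym E) A0' AB' nA.
Qed.

(** Compare the first letter with the last: a direct sum makes it smaller, a skew sum larger. *)
Lemma splits_excl w : splits ltn w -> splits gtn w -> False.
Proof.
case/splitsP=> A [B [-> A0 B0 /allrelP AB]] /splitsP [A' [B' [E A0' B0' /allrelP AB']]].
case: A A0 AB E => // x A _ AB; case: A' A0' AB' => // x' A' _ AB' [xx' E].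
case/lastP: B B0 AB E => // B y _ AB; case/lastP: B' B0' AB' => // B' y' _ AB'.
rewrite -!rcons_cat => /rcons_inj [_ yy'].
have := AB x y; have := AB' x' y'; rewrite xx' yy' !mem_head !mem_rcons !mem_head.
by move=> /(_ isT isT) /= h /(_ isT isT) /= h'; move: h h'; lia.
Qed.

Definition strict_total (r : rel nat) :=
  [/\ asym r, transitive r & forall x y, x != y -> r x y || r y x].

(** A letter [x] below all of [B] joins [A]; one above all of [B] is above [A] too and splits off
    alone. Otherwise [B] is a sum [U ++ V] for the converse order and some [v] of [V] and [u] of [U]
    satisfy v < x < u in the order [r]; with any [a] of [A], the letters x, a, u, v form 3142. *)
Lemma splits_cons r x A B : strict_total r ->
  uniq (x :: A ++ B) -> pattern_free r (x :: A ++ B) ->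
  A != [::] -> B != [::] -> allrel r A B -> ~~ splits r B ->
  (1 < size B -> splits r B || splits (conv r) B) ->
  splits r (x :: A ++ B) || splits (conv r) (x :: A ++ B).
Proof.
case=> asr trr ttr uw fw A0 B0 AB nB IH.
have xB y : y \in B -> x != y.
  move=> yB; apply: contraTneq uw => ->; rewrite /= mem_cat yB orbT //.
have [a aA] : exists a, a \in A by case: A A0 {uw fw AB} => // a A _; exists a; rewrite mem_head.
have [gtB|/allPn [y yB nxy]] := boolP (all (r x) B).
  apply/orP; left; apply/splitsP; exists (x :: A), B; split=> //.
  by rewrite allrel_consl gtB AB.
have ryx : r y x by have := ttr _ _ (xB _ yB); rewrite (negbTE nxy).
have [ltB|/allPn [z zB nzx]] := boolP (all (r^~ x) B).
  apply/orP; right; apply/splitsP; exists [:: x], (A ++ B); split=> //.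
    by case: A A0 {uw fw AB aA}.
  rewrite allrel1l all_cat ltB andbT; apply/allP => b bA.
  exact: trr (allrelP AB _ _ bA yB) ryx.
have rxz : r x z by have := ttr _ _ (xB _ zB); rewrite (negbTE nzx) orbF.
have sB : 1 < size B.
  case: B yB zB {uw fw B0 AB nB IH xB} => [|b [|//]] //=; rewrite !inE => /eqP yb /eqP zb.
  by move: (asr _ _ ryx); rewrite yb -zb rxz.
have := IH sB; rewrite (negbTE nB) /= => /splitsP [U [V [EB U0 V0 /allrelP UV]]].
have F u v : u \in U -> v \in V -> r v x -> r x u -> False.
  move=> uU vV rvx rxu.
  have rav : r a v by apply: (allrelP AB); rewrite // EB mem_cat vV orbT.
  have [_ /negP] := fw _ _ _ _ rav rvx rxu; apply.
  rewrite EB -cat1s -[x :: _]cat1s -[[:: a; u; v]]cat1s -[[:: u; v]]cat1s.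
  by rewrite !cat_subseq ?sub1seq ?mem_head.
have [u uU] : exists u, u \in U by case: U U0 {EB UV F} => // u U _; exists u; rewrite mem_head.
have [v vV] : exists v, v \in V by case: V V0 {EB UV F} => // v V _; exists v; rewrite mem_head.
have Fx : False; last by [].
(* Here y < x < z. If both lie in [U], any letter of [V] replaces [y]; if both lie in [V], any
   letter of [U] replaces [z]; [y] in [U] with [z] in [V] contradicts the order of the two parts. *)
move: yB zB; rewrite EB !mem_cat => /orP[yU|yV] /orP[zU|zV].
- exact: F z v zU vV (trr _ _ _ (UV y v yU vV) ryx) rxz.
- by move: (asr _ _ rxz); rewrite (trr _ _ _ (UV y z yU zV) ryx).
- exact: F z y zU yV ryx rxz.
- exact: F u y uU yV ryx (trr _ _ _ rxz (UV u z uU zV)).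
Qed.

Lemma strict_total_conv r : strict_total r -> strict_total (conv r).
Proof.
case=> asr trr ttr; split=> [x y|y x z h1 h2|x y xy]; first exact: asr.
  exact: trr h2 h1.
by rewrite orbC; apply: ttr.
Qed.

Lemma separable_splits r w : strict_total r -> uniq w -> pattern_free r w ->
  1 < size w -> splits r w || splits (conv r) w.
Proof.
move=> str; move: {2}(size w) (leqnn (size w)) => n.
elim: n w => [|n IH] [|x v] // sv uw fw sw.
have uv : uniq v by case/andP: uw.
have v0 : v != [::] by case: v sw {sv uw uv fw}.
have fv := pattern_free_subseq (subseq_cons v x) fw.
have [sv1|sv1] := leqP (size v) 1.
  case: v v0 sv1 {sv fv uv sw fw} uw => // y [|//] _ _ /=; rewrite inE andbT => xy.
  case: str => _ _ /(_ x y xy) /orP[h|h]; apply/orP; [left|right];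
    by apply/splitsP; exists [:: x], [:: y]; rewrite allrel1l /= h.
(* [r'] is whichever of the two orders splits the tail [v]. *)
have main r' : strict_total r' -> pattern_free r' (x :: v) -> splits r' v ->
   (forall B, subseq B v -> size B <= n -> 1 < size B -> splits r' B || splits (conv r') B) ->
   splits r' (x :: v) || splits (conv r') (x :: v).
  move=> str' fw' /splitsP sp IH'; have [A [B [E B0 AB nB]]] := last_block r' v0.
  have subB : subseq B v by rewrite E suffix_subseq.
  have A0 : A != [::].
    apply: contra nB => /eqP A0; apply/splitsP; move: sp; rewrite E A0 //.
  rewrite E in uw fw' *; apply: splits_cons => // sB; apply: IH' => //.
  by apply: leq_trans (size_subseq subB) _.
have IH' B : subseq B v -> size B <= n -> 1 < size B -> splits r B || splits (conv r) B.
  move=> subB sB sB1; apply: IH => //; first exact: subseq_uniq subB uv.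
  exact: pattern_free_subseq subB fv.
have /orP[sp|sp] := IH v sv uv fv sv1; first exact: main.
rewrite orbC; apply: (main _ (strict_total_conv str) (pattern_free_conv fw) sp).
by move=> B h1 h2 h3; rewrite orbC; apply: IH'.
Qed.

(** * Pattern containment as subsequences *)

Lemma containsP w t : reflect (exists2 u, subseq u w & order_iso u t) (contains w t).
Proof.
apply: (iffP existsP) => [[m h]|[u /subseqP [m sm ->] h]].
  by exists (mask m w); first exact: mask_subseq.
by exists (tcast sm (in_tuple m)); rewrite val_tcast.
Qed.

Lemma order_iso_2413 a b c d :
  order_iso [:: b; d; a; c] [:: 2; 4; 1; 3] = [&& a < b, b < c & c < d].
Proof.
apply/idP/idP => [/forallP h|/and3P[ab bc cd]].
  have h' i j (hi : i < 4) (hj : j < 4) := eqP (forallP (h (Ordinal hi)) (Ordinal hj)).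
  by have /= -> := h' 2 0 isT isT; have /= -> := h' 0 3 isT isT; have /= -> := h' 3 1 isT isT.
apply/forallP => -[[|[|[|[|i]]]] hi] //; apply/forallP => -[[|[|[|[|j]]]] hj] //;
  by rewrite /=; clear -ab bc cd; lia.
Qed.

Lemma order_iso_3142 a b c d :
  order_iso [:: c; a; d; b] [:: 3; 1; 4; 2] = [&& a < b, b < c & c < d].
Proof.
apply/idP/idP => [/forallP h|/and3P[ab bc cd]].
  have h' i j (hi : i < 4) (hj : j < 4) := eqP (forallP (h (Ordinal hi)) (Ordinal hj)).
  by have /= -> := h' 1 3 isT isT; have /= -> := h' 3 0 isT isT; have /= -> := h' 0 2 isT isT.
apply/forallP => -[[|[|[|[|i]]]] hi] //; apply/forallP => -[[|[|[|[|j]]]] hj] //;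
  by rewrite /=; clear -ab bc cd; lia.
Qed.

Definition sep w := avoids_all w [:: [:: 2; 4; 1; 3]; [:: 3; 1; 4; 2]].

Lemma sepP w : reflect (pattern_free ltn w) (sep w).
Proof.
rewrite /sep /avoids_all /= andbT; apply: (iffP andP) => [[n1 n2] a b c d ab bc cd|fw].
  split; [apply: contra n1|apply: contra n2] => h; apply/containsP.
    by exists [:: b; d; a; c]; rewrite ?order_iso_2413 //; apply/and3P.
  by exists [:: c; a; d; b]; rewrite ?order_iso_3142 //; apply/and3P.
split; apply/containsP => -[[|x [|y [|z [|t [|? ?]]]]] //= sw].
  by rewrite order_iso_2413 => /and3P[zx xt ty]; case: (fw _ _ _ _ zx xt ty); rewrite sw.
by rewrite order_iso_3142 => /and3P[yt tx xz]; case: (fw _ _ _ _ yt tx xz); rewrite sw.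
Qed.

Lemma strict_total_ltn : strict_total ltn.
Proof.
split=> [x y|y x z|x y]; [rewrite -leqNgt; exact: ltnW | exact: ltn_trans | by rewrite neq_ltn].
Qed.

Lemma sep_subseq v w : subseq v w -> sep w -> sep v.
Proof. by move=> vw /sepP fw; apply/sepP; apply: pattern_free_subseq fw. Qed.

Lemma sep_catl A B : sep (A ++ B) -> sep A.
Proof. exact/sep_subseq/prefix_subseq. Qed.

Lemma sep_catr A B : sep (A ++ B) -> sep B.
Proof. exact/sep_subseq/suffix_subseq. Qed.

Lemma sep_cat_lt A B : allrel ltn A B -> sep A -> sep B -> sep (A ++ B).
Proof.
move=> AB /sepP fA /sepP fB; apply/sepP/pattern_free_cat => //.
by case: strict_total_ltn.
Qed.

Lemma sep_cat_gt A B : allrel gtn A B -> sep A -> sep B -> sep (A ++ B).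
Proof.
move=> AB /sepP/pattern_free_conv fA /sepP/pattern_free_conv fB; apply/sepP.
apply: (pattern_free_conv (r := conv ltn)); apply: pattern_free_cat => //.
by case: (strict_total_conv strict_total_ltn).
Qed.

Lemma sep_size1 x : sep [:: x].
Proof.
apply/sepP => a b c d _ _ _; split; apply/negP => /size_subseq //.
Qed.

Lemma sep_mono f w : {mono f : x y / x < y} -> sep w -> sep (map f w).
Proof.
by move=> mf /sepP fw; apply/sepP; apply: pattern_free_map fw => x y _ _; rewrite /= mf.
Qed.

Lemma sep_flip M w : sep w -> sep (map (subn M) w).
Proof.
move=> /sepP/pattern_free_conv fw; apply/sepP; apply: pattern_free_map fw => x y _ _ /=.
lia.
Qed.

Lemma sep_splits w : uniq w -> sep w -> 1 < size w -> splits ltn w || splits gtn w.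
Proof. by move=> uw /sepP fw; apply: separable_splits fw => //; exact: strict_total_ltn. Qed.

(** * Dumont words *)

Definition dstep a b := if odd a then a < b else b < a.
(** The last letter has no successor and must be odd. The default 1 here, like the default 0 in
    [dumont_even], admits the empty word. *)
Definition dumont_odd w := sorted dstep w && odd (last 1 w).
(* The shape of a part of a Dumont word that is followed by a smaller letter, and also
   of the complement of a Dumont word. *)
Definition dumont_even w := sorted dstep w && ~~ odd (last 0 w).

Lemma sorted_cat (e : rel nat) a A B : sorted e (rcons A a ++ B) =
  sorted e (rcons A a) && path e a B.
Proof. by case: A => [|x A] //=; rewrite cat_path last_rcons. Qed.

(** The junction is a descent, legal exactly when the last letter of [A] is even, so the conditions
    on the two parts decouple. *)
Lemma dumont_odd_gt A B : B != [::] -> allrel gtn A B ->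
  dumont_odd (A ++ B) = dumont_even A && dumont_odd B.
Proof.
case: B => // b B _; case/lastP: A => [|A a]; first by [].
move=> AB; rewrite /dumont_odd /dumont_even sorted_cat last_cat /= !last_rcons.
have /= ba : b < a by apply: (allrelP AB); rewrite ?mem_rcons ?mem_head.
rewrite /dstep ltnNge (ltnW ba) ba /=; case: (odd a); rewrite ?andbF //=.
by rewrite !andbT andbA.
Qed.

Lemma dumont_odd_lt A B : allrel ltn A B ->
  dumont_odd (A ++ B) = dumont_odd A && dumont_odd B.
Proof.
case: B => [|b B]; first by rewrite cats0 andbT.
case/lastP: A => [|A a]; first by [].
move=> AB; rewrite /dumont_odd sorted_cat last_cat /= !last_rcons.
have /= ba : a < b by apply: (allrelP AB); rewrite ?mem_rcons ?mem_head.
rewrite /dstep [b < a]ltnNge (ltnW ba) ba /=; case: (odd a); rewrite ?andbF //=.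
by rewrite !andbT andbA.
Qed.

Lemma dumont_even_gt A B : B != [::] -> allrel gtn A B ->
  dumont_even (A ++ B) = dumont_even A && dumont_even B.
Proof.
case: B => // b B _; case/lastP: A => [|A a]; first by [].
move=> AB; rewrite /dumont_even sorted_cat last_cat /= !last_rcons.
have /= ba : b < a by apply: (allrelP AB); rewrite ?mem_rcons ?mem_head.
rewrite /dstep ltnNge (ltnW ba) ba /=; case: (odd a); rewrite ?andbF //=.
by rewrite !andbT andbA.
Qed.

(** Used to locate extreme letters: a letter with no admissible successor in [w] must end the
    word. *)
Lemma sorted_next (e : rel nat) w x : sorted e w -> x \in w ->
  (exists p, w = rcons p x) \/ exists2 y, y \in w & e x y.
Proof.
move=> sw /splitPr xw; case: w / xw sw => p [|y q]; first by left; exists p; rewrite cats1.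
rewrite -cat_rcons sorted_cat => /= /and3P[_ exy _]; right; exists y => //.
by rewrite mem_cat inE eqxx orbT.
Qed.

(** Concatenating the sorted parts gives a sorted word, hence the interval itself; the lengths then
    tell which values each part takes. *)
Lemma perm_cat_lt s A B : perm_eq (A ++ B) (iota s (size A + size B)) ->
  allrel ltn A B ->
  perm_eq A (iota s (size A)) /\ perm_eq B (iota (s + size A) (size B)).
Proof.
move=> pw AB; have E : sort leq A ++ sort leq B = iota s (size A + size B).
  apply: (sorted_eq leq_trans anti_leq); last 1 first.
  - by rewrite -(permPr pw) perm_cat // perm_sort.
  - rewrite (sorted_pairwise leq_trans) pairwise_cat -!(sorted_pairwise leq_trans).
    rewrite !(sort_sorted leq_total) !andbT; apply/allrelP => x y.
    by rewrite !mem_sort => xA yB; apply/ltnW/(allrelP AB).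
  - exact: iota_sorted.
rewrite iotaD in E; move/eqP: E; rewrite eqseq_cat ?size_sort ?size_iota //.
by case/andP=> /eqP <- /eqP <-; rewrite !(perm_sym A, perm_sym B) !perm_sort.
Qed.

Lemma sorted_dstep_shift k w :
  sorted dstep (map (addn k.*2) w) = sorted dstep w.
Proof.
rewrite sorted_map; apply: eq_sorted => x y /=.
by rewrite /dstep oddD odd_double /= !ltn_add2l.
Qed.

Lemma dumont_odd_shift k w : dumont_odd (map (addn k.*2) w) = dumont_odd w.
Proof.
rewrite /dumont_odd sorted_dstep_shift; congr andb.
by case: w => //= x w; rewrite last_map oddD odd_double.
Qed.

Lemma sorted_dstep_flip M w : odd M -> {in w, forall x, x <= M} ->
  sorted dstep (map (subn M) w) = sorted dstep w.
Proof.
move=> oM /allP wM; rewrite sorted_map; apply: eq_in_sorted wM => x y xM yM /=.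
rewrite /dstep oddB ?oM //=.
by case: (odd x) => /=; rewrite /in_mem /= in xM yM; rewrite /=; apply/idP/idP; lia.
Qed.

Lemma odd_last_flip M w a b : odd M -> {in w, forall x, x <= M} -> odd a = ~~ odd b ->
  odd (last a (map (subn M) w)) = ~~ odd (last b w).
Proof.
move=> oM wM ab; case: w wM => //= x w wM.
rewrite last_map oddB ?oM ?wM ?mem_last //.
Qed.

Lemma dumont_even_flip M w : odd M -> {in w, forall x, x <= M} ->
  dumont_even (map (subn M) w) = dumont_odd w.
Proof.
move=> oM wM; rewrite /dumont_odd /dumont_even sorted_dstep_flip //.
by rewrite (@odd_last_flip _ _ 0 1) // negbK.
Qed.

Lemma dumont_odd_flip M w : odd M -> {in w, forall x, x <= M} ->
  dumont_odd (map (subn M) w) = dumont_even w.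
Proof.
move=> oM wM; rewrite /dumont_odd /dumont_even sorted_dstep_flip //.
by rewrite (@odd_last_flip _ _ 1 0).
Qed.

Lemma perm_iota_shift s k m w :
  perm_eq w (iota s m) -> perm_eq (map (addn k) w) (iota (k + s) m).
Proof. by move=> pw; rewrite iotaDl perm_map. Qed.

Lemma perm_iota_flip s t m w :
  perm_eq w (iota s m) -> s <= t -> perm_eq (map (subn (t + m).-1) w) (iota (t - s) m).
Proof.
move=> pw st; apply: (perm_trans (perm_map _ pw)).
have E : map (subn (t + m).-1) (iota s m) =i iota (t - s) m.
  move=> x; apply/mapP/idP => [[y]|]; rewrite !mem_iota; first by move=> ? ->; lia.
  by move=> hx; exists ((t + m).-1 - x); rewrite ?mem_iota; lia.
apply: uniq_perm E; rewrite ?iota_uniq //.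
rewrite map_inj_in_uniq ?iota_uniq // => x y; rewrite !mem_iota; lia.
Qed.

(** * Recursion from the first direct component *)

Definition dumont_words n := [seq w <- permutations (iota 1 n.*2) | dumont_odd w && sep w].
Definition skew_sums n := [seq w <- dumont_words n | splits gtn w].
Definition direct_sums n := [seq w <- dumont_words n | splits ltn w].

Lemma mem_dumont_words n w : (w \in dumont_words n) =
  [&& perm_eq w (iota 1 n.*2), dumont_odd w & sep w].
Proof. by rewrite mem_filter mem_permutations andbC. Qed.

Lemma dumont_words_uniq n : uniq (dumont_words n).
Proof. exact/filter_uniq/permutations_uniq. Qed.

Lemma dumont_words_size n w : w \in dumont_words n -> size w = n.*2.
Proof. by rewrite mem_dumont_words => /and3P[/perm_size -> _ _]; rewrite size_iota. Qed.

Lemma dumont_words_word_uniq n w : w \in dumont_words n -> uniq w.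
Proof. by rewrite mem_dumont_words => /and3P[/perm_uniq -> _ _]; rewrite iota_uniq. Qed.

Lemma dumont_words_nil n : ([::] \in dumont_words n) = (n == 0).
Proof.
apply/idP/eqP => [/dumont_words_size /= | ->]; first lia.
by rewrite mem_dumont_words; apply/sepP => a b c d _ _ _; split.
Qed.

(** A nonempty word has even length, hence at least two letters, and separability makes it a sum of
    exactly one kind. *)
Lemma dumont_words_splits n w : w \in dumont_words n -> w != [::] ->
  splits gtn w = ~~ splits ltn w.
Proof.
move=> wD w0; have := dumont_words_word_uniq wD; have := dumont_words_size wD.
move: wD; rewrite mem_dumont_words => /and3P[_ _ sw] szw uw.
have /(sep_splits uw sw) : 1 < size w by move: w0; rewrite -size_eq0; lia.
by have := @splits_excl w; case: splits; case: splits => // /(_ isT isT).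
Qed.

Lemma size_dumont_words n :
  size (dumont_words n) = (n == 0) + size (skew_sums n) + size (direct_sums n).
Proof.
rewrite /skew_sums /direct_sums ![size [seq _ <- dumont_words n | _]]size_filter.
rewrite -dumont_words_nil -count_uniq_mem ?dumont_words_uniq //.
have E : {in dumont_words n, predC (pred1 [::]) =1 predU (splits gtn) (splits ltn)}.
  move=> w wD /=; have [->|w0] //= := eqVneq w [::].
  by rewrite (dumont_words_splits wD w0) orNb.
rewrite -addnA -count_predUI -(count_predC (pred1 [::]) (dumont_words n)) (eq_in_count E).
rewrite [X in _ = _ + (_ + X)](_ : _ = 0) ?addn0 //.
apply/eqP; rewrite -leqn0 leqNgt -has_count; apply/hasPn => w _ /=.
by apply/negP => /andP[h1 h2]; exact: splits_excl h2 h1.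
Qed.

Lemma shift_words k m w : w \in dumont_words m ->
  [/\ perm_eq (map (addn k.*2) w) (iota k.*2.+1 m.*2),
      dumont_odd (map (addn k.*2) w) & sep (map (addn k.*2) w)].
Proof.
rewrite mem_dumont_words => /and3P[pw dw sw]; rewrite dumont_odd_shift -addn1 perm_iota_shift //.
by split=> //; apply: sep_mono sw => x y; rewrite ltn_add2l.
Qed.

Lemma shift_words_inv k m w : perm_eq w (iota k.*2.+1 m.*2) -> dumont_odd w -> sep w ->
  exists2 v, v \in dumont_words m & w = map (addn k.*2) v.
Proof.
move=> pw dw sw; have E : w = map (addn k.*2) (map (subn^~ k.*2) w).
  rewrite -map_comp map_id_in // => x; rewrite (perm_mem pw) mem_iota /=; lia.
exists (map (subn^~ k.*2) w) => //; rewrite mem_dumont_words -(dumont_odd_shift k) -E dw /=.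
apply/andP; split; last first.
  move/sepP: sw => fw; apply/sepP; apply: pattern_free_map fw => x y _ _ /=; lia.
apply: (perm_trans (perm_map _ pw)).
rewrite -addn1 iotaDl -map_comp map_id_in // => x _ /=; lia.
Qed.

(** The constant 2(k + m) + 1 is odd, as the exchange of parities requires, and sends 1, ..., 2m
    onto 2k + 1, ..., 2k + 2m. *)
Lemma flip_words k m w : w \in dumont_words m ->
  [/\ perm_eq (map (subn (k + m).*2.+1) w) (iota k.*2.+1 m.*2),
      dumont_even (map (subn (k + m).*2.+1) w) & sep (map (subn (k + m).*2.+1) w)].
Proof.
rewrite mem_dumont_words => /and3P[pw dw sw]; split; last exact: sep_flip.
  have := perm_iota_flip (t := k.*2.+2) pw isT.
  by rewrite subSS subn0 addSn /= doubleD.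
rewrite dumont_even_flip //= ?odd_double // => x.
by rewrite (perm_mem pw) mem_iota; lia.
Qed.

Lemma flip_words_inv k m w : perm_eq w (iota k.*2.+1 m.*2) -> dumont_even w -> sep w ->
  exists2 v, v \in dumont_words m & w = map (subn (k + m).*2.+1) v.
Proof.
move=> pw dw sw; have wM x : x \in w -> x <= (k + m).*2.+1.
  by rewrite (perm_mem pw) mem_iota; lia.
exists (map (subn (k + m).*2.+1) w); last first.
  by rewrite -map_comp map_id_in // => x /wM /=; lia.
rewrite mem_dumont_words dumont_odd_flip //= ?odd_double // dw sep_flip // !andbT.
have := perm_iota_flip (t := k.*2.+2) pw (leqnSn _).
by rewrite subSS subSn // subnn addSn /= doubleD.
Qed.

Lemma skew_sums_sub n w : w \in skew_sums n ->
  [/\ w \in dumont_words n, w != [::] & ~~ splits ltn w].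
Proof.
rewrite mem_filter => /andP[gw wD]; have w0 : w != [::] by case: w gw {wD}.
by rewrite -(dumont_words_splits wD w0).
Qed.

Lemma direct_sums_sub n w : w \in direct_sums n ->
  [/\ w \in dumont_words n, w != [::] & ~~ splits gtn w].
Proof.
rewrite mem_filter => /andP[gw wD]; have w0 : w != [::] by case: w gw {wD}.
by rewrite (dumont_words_splits wD w0) gw.
Qed.

Lemma skew_sums0 : skew_sums 0 = [::].
Proof. by rewrite /skew_sums /dumont_words /=; case: ifP. Qed.

Lemma direct_sums0 : direct_sums 0 = [::].
Proof. by rewrite /direct_sums /dumont_words /=; case: ifP. Qed.

Lemma size_dumont_words0 : size (dumont_words 0) = 1.
Proof. by rewrite size_dumont_words skew_sums0 direct_sums0. Qed.

(* The minimum |A| + 1 of B would be an even letter of B without descent. *)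
Lemma first_block_even m A B : perm_eq (A ++ B) (iota 1 m.*2) -> allrel ltn A B ->
  dumont_odd B -> ~~ odd (size A).
Proof.
move=> pw AB /andP[sB oB].
have szE : size A + size B = m.*2 by rewrite -size_cat (perm_size pw) size_iota.
have [pA pB] : perm_eq A (iota 1 (size A)) /\ perm_eq B (iota (1 + size A) (size B)).
  by apply: perm_cat_lt; rewrite ?szE.
apply/negP => oA; have xB : (size A).+1 \in B by rewrite (perm_mem pB) mem_iota; lia.
case: (sorted_next sB xB) => [[p Bp]|[y]].
  by move: oB; rewrite Bp last_rcons /= oA.
by rewrite (perm_mem pB) mem_iota /dstep /= oA /=; lia.
Qed.

(** The first component does not split as a direct sum and, having even length, is not a single
    letter: it is a skew sum. The rest is a Dumont word shifted by 2k, which keeps all parities. *)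
Lemma dumont_words_rec n :
  size (dumont_words n) = (n == 0) +
    \sum_(0 <= k < n.+1) size (skew_sums k) * size (dumont_words (n - k)).
Proof.
have [->|n0] := posnP n; first by rewrite big_nat1 skew_sums0 size_dumont_words0.
rewrite add0n.
apply: (size_decomp (LV := fun k => dumont_words (n - k))
  (f := fun k u v => u ++ map (addn k.*2) v)).
- exact: dumont_words_uniq.
- exact: iota_uniq.
- by move=> k; apply/filter_uniq/dumont_words_uniq.
- by move=> k; apply: dumont_words_uniq.
- move=> k u v; rewrite mem_index_iota => kn /skew_sums_sub [uD _ _] vD.
  have [pv dv sv] := shift_words k vD.
  move: uD; rewrite mem_dumont_words => /and3P[pu du su].
  have uv : allrel ltn u (map (addn k.*2) v).
    apply/allrelP => x y; rewrite (perm_mem pu) (perm_mem pv) !mem_iota /=; clear; lia.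
  rewrite mem_dumont_words dumont_odd_lt // du dv sep_cat_lt // !andbT.
  have -> : n.*2 = k.*2 + (n - k).*2 by rewrite -doubleD subnKC.
  by rewrite iotaD perm_cat.
- move=> w wD; have w0 : w != [::].
    by apply: contraTneq wD => ->; rewrite dumont_words_nil; lia.
  have [A [B [E A0 AB nA]]] := first_block ltn w0.
  have szw := dumont_words_size wD; move: wD; rewrite mem_dumont_words E => /and3P[pw dw sw].
  move: dw; rewrite dumont_odd_lt // => /andP[dA dB].
  have szE : size A + size B = n.*2 by rewrite -size_cat -E.
  have [pA pB] : perm_eq A (iota 1 (size A)) /\ perm_eq B (iota (1 + size A) (size B)).
    by apply: perm_cat_lt; rewrite ?szE.
  have [k eA] : exists k, size A = k.*2.
    by exists (size A)./2; rewrite even_halfK ?(first_block_even pw).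
  have [kn eB] : k < n.+1 /\ size B = (n - k).*2 by clear -szE eA; lia.
  have AD : A \in dumont_words k by rewrite mem_dumont_words -eA pA dA (sep_catl sw).
  have [|v vD Bv] := shift_words_inv (k := k) (m := n - k) _ dB (sep_catr sw).
    by rewrite -eB -eA.
  exists k, A, v; split; rewrite -?Bv ?mem_index_iota //.
  by rewrite mem_filter AD (dumont_words_splits AD A0) nA.
- move=> k u v k' u' v' _ /skew_sums_sub [uD u0 nu] vD _ /skew_sums_sub [uD' u0' nu'] vD' E.
  have uvlt j x y : x \in dumont_words j -> y \in dumont_words (n - j) ->
      allrel ltn x (map (addn j.*2) y).
    move=> xD yD; have [py _ _] := shift_words j yD.
    move: xD; rewrite mem_dumont_words => /and3P[px _ _].
    apply/allrelP => a b; rewrite (perm_mem px) (perm_mem py) !mem_iota /=; clear; lia.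
  have [uu vv] := first_block_inj E u0 u0' (uvlt _ _ _ uD vD) (uvlt _ _ _ uD' vD') nu nu'.
  have kk : k = k' by apply: double_inj; rewrite -(dumont_words_size uD) uu (dumont_words_size uD').
  split=> //; move: vv; rewrite kk; apply: inj_map; exact: addnI.
Qed.

(** * Recursion from the last skew component *)

Lemma perm_cat_gt s A B : perm_eq (A ++ B) (iota s (size A + size B)) ->
  allrel gtn A B ->
  perm_eq B (iota s (size B)) /\ perm_eq A (iota (s + size B) (size A)).
Proof.
move=> pw AB; apply: perm_cat_lt.
  by rewrite perm_catC addnC.
by rewrite allrelC; apply: etrans AB; apply: eq_allrel.
Qed.

Definition nonempty_words n := [seq w <- dumont_words n | w != [::]].

Lemma size_nonempty_words n : size (nonempty_words n) = size (dumont_words n) - (n == 0).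
Proof.
rewrite size_filter -(count_predC (pred1 [::]) (dumont_words n)).
rewrite count_uniq_mem ?dumont_words_uniq //.
by rewrite dumont_words_nil addKn.
Qed.

(* A skew-decomposable word is determined by its last skew block and the word
   above it. If the block has even length 2k, it is a Dumont word and the upper
   part a flipped one. If it has length 2k+1, then its maximum 2k+1 must come
   last in it, and the next value 2k+2 must come last in the upper part. *)
Definition lower_block (i : bool * nat) v := if i.1 then rcons v i.2.*2.+1 else v.
Definition upper_block n (i : bool * nat) u :=
  let u' := map (subn n.*2.+1) u in if i.1 then rcons u' i.2.*2.+2 else u'.
Definition lower_words (i : bool * nat) := if i.1 then dumont_words i.2 else direct_sums i.2.
Definition upper_words n (i : bool * nat) :=
  if i.1 then dumont_words (n.-1 - i.2) else nonempty_words (n - i.2).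
Definition block_index n := [seq (false, k) | k <- index_iota 0 n.+1] ++
                            [seq (true, k) | k <- index_iota 0 n].

Lemma mem_block_index n i : (i \in block_index n) = (i.1 + i.2 <= n).
Proof.
have mt b b' (k : nat) s : ((b, k) \in [seq (b' : bool, j) | j <- s]) = (b == b') && (k \in s).
  apply/mapP/andP => [[j js [-> ->]]|[/eqP -> ks]]; first by rewrite eqxx.
  by exists k.
case: i => b k; rewrite mem_cat !mt !mem_index_iota; case: b => /=.
  by rewrite add1n.
by rewrite orbF add0n.
Qed.

Lemma block_index_uniq n : uniq (block_index n).
Proof.
rewrite cat_uniq !map_inj_uniq ?iota_uniq; try by move=> ? ? [].
by rewrite andbT; apply/hasPn => _ /mapP [k _ ->]; apply/negP => /mapP [].
Qed.

Lemma lower_block_spec i v : v \in lower_words i ->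
  [/\ perm_eq (lower_block i v) (iota 1 (i.1 + i.2.*2)),
      dumont_odd (lower_block i v), sep (lower_block i v),
      lower_block i v != [::] & ~~ splits gtn (lower_block i v)].
Proof.
case: i => [[] k]; rewrite /lower_words /lower_block /= => vD; last first.
  have {vD} [vD v0 nv] := direct_sums_sub vD.
  by move: vD; rewrite mem_dumont_words => /and3P[pv dv sv].
move: vD; rewrite mem_dumont_words => /and3P[pv dv sv].
have vx : allrel ltn v [:: k.*2.+1].
  by rewrite allrel1r; apply/allP => x; rewrite (perm_mem pv) mem_iota /=; clear; lia.
have pw : perm_eq (rcons v k.*2.+1) (iota 1 (1 + k.*2)).
  by rewrite addnC iotaD /= add1n -cats1 perm_cat2r.
split=> //.
- by rewrite -cats1 dumont_odd_lt // dv /dumont_odd /= odd_double.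
- by rewrite -cats1 sep_cat_lt // sep_size1.
- by rewrite -size_eq0 size_rcons.
(* A skew splitting of the odd block would put a letter above the final one, which is its maximum 2k
   + 1. *)
apply/splitsP => -[A [B [E A0 B0 /allrelP AB]]].
case/lastP: B B0 E AB => // B b _; rewrite -rcons_cat => /rcons_inj [vE <-] AB.
case: A A0 vE AB => // a A _ vE AB.
have := AB a k.*2.+1; rewrite mem_head mem_rcons mem_head => /(_ isT isT).
have : a \in v by rewrite vE mem_head.
by rewrite (perm_mem pv) mem_iota /=; clear; lia.
Qed.

Lemma upper_block_spec n (i : bool * nat) u : i.1 + i.2 <= n -> u \in upper_words n i ->
  [/\ perm_eq (upper_block n i u) (iota (i.1 + i.2.*2).+1 (n.*2 - (i.1 + i.2.*2))),
      dumont_even (upper_block n i u), sep (upper_block n i u) &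
      upper_block n i u != [::]].
Proof.
case: i => [[] k]; rewrite /upper_words /upper_block /= ?add1n ?add0n => kn; last first.
  rewrite mem_filter => /andP[u0 uD]; have := flip_words k uD.
  rewrite subnKC // -doubleB => -[pu du su]; split=> //.
  by case: u u0 {uD pu du su}.
(* The flipped word takes the values 2k + 3, ..., 2n, leaving 2k + 2 to be appended below it. *)
move=> uD; have := flip_words k.+1 uD.
have -> : (k.+1 + (n.-1 - k)) = n by clear -kn; lia.
have -> : n.*2 - k.*2.+1 = (n.-1 - k).*2.+1 by clear -kn; lia.
case=> pu du su.
have ux : allrel gtn (map (subn n.*2.+1) u) [:: k.*2.+2].
  by rewrite allrel1r; apply/allP => x; rewrite (perm_mem pu) mem_iota /=; clear; lia.
split.
- by rewrite perm_rcons /= perm_cons.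
- by rewrite -cats1 dumont_even_gt // du /dumont_even /= odd_double.
- by rewrite -cats1 sep_cat_gt // sep_size1.
- by rewrite -size_eq0 size_rcons.
Qed.

Lemma blocks_gt n b A B : perm_eq A (iota b.+1 (n - b)) -> perm_eq B (iota 1 b) ->
  allrel gtn A B.
Proof.
move=> pA pB; apply/allrelP => x y; rewrite (perm_mem pA) (perm_mem pB) !mem_iota /=.
clear; lia.
Qed.

Lemma flipK n m u : m <= n -> u \in dumont_words m ->
  map (subn n.*2.+1) (map (subn n.*2.+1) u) = u.
Proof.
move=> mn; rewrite mem_dumont_words => /and3P[pu _ _].
rewrite -map_comp map_id_in // => x; rewrite (perm_mem pu) mem_iota /=.
by clear -mn; lia.
Qed.

Lemma upper_block_inj n (i : bool * nat) u u' : i.1 + i.2 <= n ->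
  u \in upper_words n i -> u' \in upper_words n i ->
  upper_block n i u = upper_block n i u' -> u = u'.
Proof.
case: i => [[] k]; rewrite /upper_words /upper_block /= ?add1n ?add0n => kn.
  move=> uD uD' /rcons_inj [/(congr1 (map (subn n.*2.+1)))].
  by rewrite !(@flipK n (n.-1 - k)) //; clear -kn; lia.
rewrite mem_filter => /andP[_ uD]; rewrite mem_filter => /andP[_ uD'] /(congr1 (map (subn n.*2.+1))).
by rewrite !(@flipK n (n - k)) ?leq_subr //.
Qed.

Lemma lower_block_inj i v v' : lower_block i v = lower_block i v' -> v = v'.
Proof. by case: i => [[] k] //= /rcons_inj []. Qed.

(** The maximum 2k + 1 is odd but finds no larger letter to ascend to, so it must stand last. *)
Lemma odd_block k B : size B = k.*2.+1 -> perm_eq B (iota 1 (size B)) ->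
  dumont_odd B -> sep B ->
  exists2 v, v \in dumont_words k & B = lower_block (true, k) v.
Proof.
move=> szB pB dB sB.
have xB : k.*2.+1 \in B by rewrite (perm_mem pB) szB mem_iota; clear; lia.
case/andP: (dB) => stB _; case: (sorted_next stB xB) => [[v Bv]|[y]]; last first.
  by rewrite (perm_mem pB) szB mem_iota /dstep /= odd_double /=; clear; lia.
exists v => //; rewrite szB Bv -addn1 iotaD -cats1 add1n addn1 perm_cat2r in pB.
have vx : allrel ltn v [:: k.*2.+1].
  by rewrite allrel1r; apply/allP => x; rewrite (perm_mem pB) mem_iota /=; clear; lia.
rewrite Bv -cats1 dumont_odd_lt // in dB; rewrite Bv -cats1 in sB.
by case/andP: dB => dB _; rewrite mem_dumont_words pB dB (sep_catl sB).
Qed.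

(** Dually, the minimum 2k + 2 is even, finds no smaller letter to descend to, and so must stand
    last. *)
Lemma odd_upper_block n k A : k < n ->
  perm_eq A (iota k.*2.+2 (n.-1 - k).*2.+1) -> dumont_even A -> sep A ->
  exists2 u, u \in dumont_words (n.-1 - k) & A = upper_block n (true, k) u.
Proof.
move=> kn pA dA sA.
have xA : k.*2.+2 \in A by rewrite (perm_mem pA) mem_iota; clear; lia.
case/andP: (dA) => stA _; case: (sorted_next stA xA) => [[u Au]|[y]]; last first.
  by rewrite (perm_mem pA) mem_iota /dstep /= odd_double /=; clear; lia.
rewrite Au perm_rcons /= perm_cons in pA.
have ux : allrel gtn u [:: k.*2.+2].
  by rewrite allrel1r; apply/allP => x; rewrite (perm_mem pA) mem_iota /=; clear; lia.
rewrite Au -cats1 dumont_even_gt // in dA; rewrite Au -cats1 in sA.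
case/andP: dA => dA _.
have [v vD uv] := flip_words_inv (k := k.+1) pA dA (sep_catl sA).
exists v => //; rewrite Au uv /upper_block /=; congr (rcons (map (subn _.*2.+1) _) _).
by clear -kn; lia.
Qed.

Lemma skew_sums_blocks n w : w \in skew_sums n -> exists i u v,
  [/\ i \in block_index n, u \in upper_words n i, v \in lower_words i &
      w = upper_block n i u ++ lower_block i v].
Proof.
rewrite mem_filter => /andP[gw wD]; have w0 : w != [::] by case: w gw {wD}.
have [A [B [E B0 AB nB]]] := last_block gtn w0.
have A0 : A != [::] by apply: contraNneq nB => A0; rewrite E A0 in gw.
have szw := dumont_words_size wD; move: wD; rewrite mem_dumont_words E => /and3P[pw dw sw].
move: dw; rewrite dumont_odd_gt // => /andP[dA dB].
have szE : size A + size B = n.*2 by rewrite -size_cat -E.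
have [pB pA] : perm_eq B (iota 1 (size B)) /\ perm_eq A (iota (1 + size B) (size A)).
  by apply: perm_cat_gt; rewrite ?szE.
have [sA sB] := (sep_catl sw, sep_catr sw).
have A0' : 0 < size A by rewrite lt0n size_eq0.
have [k [eB|eB]] : exists k, size B = k.*2 \/ size B = k.*2.+1.
  by exists (size B)./2; clear; lia.
- have [kn eA] : k <= n /\ size A = (n - k).*2 by clear -szE eB; lia.
  rewrite eB add1n eA in pA.
  have [u uD Au] := flip_words_inv pA dA sA; rewrite subnKC // in Au.
  have BD : B \in dumont_words k by rewrite mem_dumont_words -eB pB dB.
  exists (false, k), u, B; rewrite mem_block_index /upper_block -Au; split=> //=.
    rewrite /upper_words /= mem_filter uD andbT.
    by apply: contraNneq A0 => u0; rewrite Au u0.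
  by rewrite mem_filter BD andbT -[splits ltn B]negbK -(dumont_words_splits BD B0).
have [kn eA] : k < n /\ size A = (n.-1 - k).*2.+1 by clear -szE eB A0'; lia.
rewrite eB add1n eA in pA.
have [u uD Au] := odd_upper_block kn pA dA sA.
have [v vD Bv] := odd_block eB pB dB sB.
by exists (true, k), u, v; rewrite mem_block_index -Au -Bv; split=> //; rewrite add1n.
Qed.

(** The first sum collects the last blocks of even length and is the coefficient of (D - 1) S. The
    second collects those of odd length and is that of x D^2, the factor x standing for the two
    extra letters 2k + 1 and 2k + 2. *)
Lemma skew_sums_rec n : size (skew_sums n) =
  \sum_(0 <= k < n.+1) (size (dumont_words (n - k)) - (n - k == 0)) * size (direct_sums k) +
  \sum_(0 <= k < n) size (dumont_words (n.-1 - k)) * size (dumont_words k).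
Proof.
rewrite (size_decomp (K := block_index n) (LU := upper_words n) (LV := lower_words)
  (f := fun i u v => upper_block n i u ++ lower_block i v)).
- rewrite big_cat !big_map /=; congr addn; apply: eq_bigr => k _ //.
  by rewrite /upper_words /= size_nonempty_words.
- exact/filter_uniq/dumont_words_uniq.
- exact: block_index_uniq.
- by case=> [[] k]; [exact: dumont_words_uniq | exact/filter_uniq/dumont_words_uniq].
- by case=> [[] k]; [exact: dumont_words_uniq | exact/filter_uniq/dumont_words_uniq].
- move=> i u v; rewrite mem_block_index => ikn uD vD.
  have [pu du su u0] := upper_block_spec ikn uD.
  have [pv dv sv v0 _] := lower_block_spec vD.
  have uv := blocks_gt pu pv.
  rewrite mem_filter mem_dumont_words dumont_odd_gt // du dv sep_cat_gt // !andbT.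
  apply/andP; split; first by apply/splitsP; exists (upper_block n i u), (lower_block i v).
  have -> : n.*2 = (i.1 + i.2.*2) + (n.*2 - (i.1 + i.2.*2)).
    by clear -ikn; case: i ikn => [[] k] /=; lia.
  by rewrite perm_catC iotaD add1n perm_cat.
- exact: skew_sums_blocks.
move=> i u v i' u' v'; rewrite !mem_block_index => ikn uD vD ikn' uD' vD' E.
have [pu _ _ u0] := upper_block_spec ikn uD.
have [pv _ _ v0 nv] := lower_block_spec vD.
have [pu' _ _ u0'] := upper_block_spec ikn' uD'.
have [pv' _ _ v0' nv'] := lower_block_spec vD'.
have [uu vv] := last_block_inj E v0 v0' (blocks_gt pu pv) (blocks_gt pu' pv') nv nv'.
(* The length of the last block determines the index: its parity gives the Boolean, its half gives
   [k]. *)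
have ii : i = i'.
  have := perm_size pv; have := perm_size pv'; rewrite vv !size_iota => ->.
  by clear; case: i i' => [[] k] [[] k'] /= h; congr pair; lia.
rewrite -ii in uu vv uD'; split=> //; last exact: lower_block_inj vv.
exact: upper_block_inj uu.
Qed.

(** * Permutations and their words *)

Lemma oneline_inj m : injective (@oneline m).
Proof.
move=> s t /eq_in_map h; apply/permP => i; apply/val_inj/succn_inj/h.
by rewrite mem_enum.
Qed.

Lemma oneline_perm m (s : 'S_m) : perm_eq (oneline s) (iota 1 m).
Proof.
have -> : oneline s = map (fun i : 'I_m => (val i).+1) (map s (enum 'I_m)).
  by rewrite -map_comp.
have -> : iota 1 m = map (fun i : 'I_m => (val i).+1) (enum 'I_m).
  by rewrite (iotaDl 1) -val_enum_ord -map_comp.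
apply: perm_map.
apply: uniq_perm; last 1 first.
- move=> i; rewrite mem_enum; apply/mapP; exists (s^-1%g i).
    by rewrite mem_enum.
  by rewrite permKV.
- by rewrite map_inj_uniq ?enum_uniq //; exact: perm_inj.
- exact: enum_uniq.
Qed.

(** One inclusion suffices, since both lists are duplicate-free and have m! entries. *)
Lemma onelines_permutations m :
  perm_eq [seq oneline s | s <- enum 'S_m] (permutations (iota 1 m)).
Proof.
have ul : uniq [seq oneline s | s <- enum 'S_m].
  by rewrite map_inj_uniq ?enum_uniq //; apply: oneline_inj.
apply: uniq_perm => //; first exact: permutations_uniq.
apply: (uniq_min_size ul _ _).2 => [w /mapP [s _ ->]|].
  by rewrite mem_permutations oneline_perm.
by rewrite size_permutations ?iota_uniq // size_iota size_map -cardE card_Sn.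
Qed.

Lemma dumont1_wordE w : dumont1_word w = dumont_odd w.
Proof.
apply/forallP/andP => [h|[/(sortedP 0) st ol] [i hi]] /=; last first.
  have [lt|ge] := ltnP i.+1 (size w).
    by have := st i lt; rewrite /dstep; case: odd => //= ->; rewrite orbT.
  have e : i = (size w).-1 by clear -hi ge; lia.
  have w0 : w != [::] by case: (w) hi.
  have -> : odd (nth 0 w i).
    by rewrite e nth_last; case: (w) ol w0.
  by rewrite /= eqn_leq hi ge.
split.
  apply/(sortedP 0) => i hi; have := h (Ordinal (ltnW hi)); rewrite /= hi /dstep.
  by case: odd; rewrite //= (ltn_eqF hi).
case: w h => // x w h; have := h ord_max; rewrite /= ltnn andFb -last_nth.
by case: odd.
Qed.

Lemma D1_size n : D1_2413_3142 n = size (dumont_words n).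
Proof.
rewrite /D1_2413_3142 cardE /enum_mem size_filter /dumont_words size_filter.
rewrite -(seq.permP (onelines_permutations _)) count_map enumT.
by apply: eq_count => s /=; rewrite inE dumont1_wordE.
Qed.

(** * Generating functions *)

Local Open Scope classical_set_scope.
Local Open Scope ring_scope.

(** With the multiple of X^N explicit, consequences of congruences become polynomial identities for
    [ring]. *)
Lemma eq_coef_mod (R : comNzRingType) N (f g : {poly R}) :
  (forall i, (i < N)%N -> f`_i = g`_i) -> exists h, f = g + 'X^N * h.
Proof.
move=> fg; exists (drop_poly N f - drop_poly N g).
rewrite -{1}(poly_take_drop N f) -{1}(poly_take_drop N g).
have -> : take_poly N f = take_poly N g.
  by apply/polyP => i; rewrite !coef_take_poly; case: ifP => // /fg.
by rewrite mulrBr ![_ * 'X^N]mulrC -addrA [X in _ = _ + X]addrC subrK.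
Qed.

(* P (1 - P)^2 = P^3 + X follows from D (1 - P) = 1, since then (D - 1) (1 - P) = P
   and (D - 1 - P) (1 - P) = P^2. *)
Lemma skew_equation_mod (R : comNzRingType) (P D S X m a b c : R) :
  D = (1 + P * D) + m * a -> D = (1 + P + S) + m * b ->
  P = ((D - 1) * S + X * (D * D)) + m * c ->
  exists h, P = X + 2%:R * P ^+ 2 + m * h.
Proof.
move=> Ea Eb Ec.
exists (c * (1 - P) ^+ 2 - (D - 1) * (1 - P) ^+ 2 * b + a * (P + P ^+ 2 + m * a)
  + X * (2%:R * a + m * a ^+ 2)).
have za : D - (1 + P * D + m * a) = 0 by apply/eqP; rewrite subr_eq0; apply/eqP.
have zb : D - (1 + P + S + m * b) = 0 by apply/eqP; rewrite subr_eq0; apply/eqP.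
have zc : P - ((D - 1) * S + X * (D * D) + m * c) = 0.
  by apply/eqP; rewrite subr_eq0; apply/eqP.
clear Ea Eb Ec; apply/eqP; rewrite -subr_eq0; apply/eqP.
transitivity ((1 - P) ^+ 2 * (P - ((D - 1) * S + X * (D * D) + m * c))
  - (D - 1) * (1 - P) ^+ 2 * (D - (1 + P + S + m * b))
  + (D - (1 + P * D + m * a)) *
    (P + P ^+ 2 + 2%:R * m * a + (D - (1 + P * D + m * a)) +
     X * (2%:R * (1 + m * a) + (D - (1 + P * D + m * a))))); first by ring.
by rewrite za zb zc !(mulr0, mul0r, subr0, addr0).
Qed.

(** Multiply D (1 - P) = 1 by 1 + 2P and use (1 - P)(1 + 2P) = 1 + P - 2P^2 = 1 + X. *)
Lemma dumont_equation_mod (R : comNzRingType) (P D X m a h : R) :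
  D = (1 + P * D) + m * a -> P = X + 2%:R * P ^+ 2 + m * h ->
  exists k, D + X * D = 1 + 2%:R * P + m * k.
Proof.
move=> Ea Eh; exists (a * (1 + 2%:R * P) - D * h).
have za : D - (1 + P * D + m * a) = 0 by apply/eqP; rewrite subr_eq0; apply/eqP.
have zh : P - (X + 2%:R * P ^+ 2 + m * h) = 0 by apply/eqP; rewrite subr_eq0; apply/eqP.
clear Ea Eh; apply/eqP; rewrite -subr_eq0; apply/eqP.
transitivity ((1 + 2%:R * P) * (D - (1 + P * D + m * a))
   - D * (P - (X + 2%:R * P ^+ 2 + m * h))); first by ring.
by rewrite za zh !(mulr0, subr0).
Qed.

(** * Catalan and ballot numbers *)

Lemma central_bin_succ n : (n.+1 * 'C(n.+1.*2, n.+1) = 2 * (n.*2.+1 * 'C(n.*2, n)))%N.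
Proof.
have := mul_bin_diag n.+1.*2 n; have := mul_bin_down n.*2.+1 n; rewrite doubleS /=.
by rewrite (_ : n.*2.+1 - n = n.+1)%N; [nia|lia].
Qed.

(** The integer division in [catalan] is exact, with quotient C(2n, n) - C(2n, n+1). *)
Lemma catalan_bin n : (catalan n * n.+1 = 'C(n.*2, n))%N.
Proof.
rewrite /catalan divnK //; apply/dvdnP; exists ('C(n.*2, n) - 'C(n.*2, n.+1))%N.
have := mul_bin_left n.*2 n; rewrite (_ : n.*2 - n = n)%N; last lia.
by nia.
Qed.

(* Ballot numbers: B(n, k) = (n - k) / (n + k) * C(n + k, n) for n + k > 0, in a form
   that is subject to Pascal's rule also for k = 0. *)
Definition ballot (R : pzRingType) n k : R :=
  'C(n + k, k)%:R - 2 * (if k is j.+1 then 'C(n + j, j) else 0)%:R.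

Lemma ballot_pascal (R : comPzRingType) n k :
  ballot R n.+1 k.+1 = ballot R n k.+1 + ballot R n.+1 k.
Proof.
have e1 : 'C(n.+1 + k.+1, k.+1) = ('C(n + k.+1, k.+1) + 'C(n.+1 + k, k))%N.
  by rewrite addSn addnS binS addSnnS addnS.
have e2 : 'C(n.+1 + k, k) = ('C(n + k, k) + (if k is j.+1 then 'C(n.+1 + j, j) else 0))%N.
  by case: k {e1} => [|k]; rewrite ?bin0 // addSn binS addnS addSn.
by rewrite /ballot e1 {2}e2 !natrD; ring.
Qed.

Lemma ballot_diag (R : pzRingType) n : ballot R n n = (n == 0)%:R.
Proof.
case: n => [|n]; first by rewrite /ballot bin0 mulr0 subr0.
have := mul_bin_diag n.+1.*2 n; rewrite /ballot addnn doubleS /= => h.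
have -> : 'C(n.*2.+2, n.+1) = (2 * 'C(n.+1 + n, n))%N.
  apply/eqP; rewrite -(eqn_pmul2l (ltn0Sn n)) -h addSn addnn; apply/eqP; clear h.
  by rewrite -doubleS -mul2n; nia.
by rewrite natrM subrr.
Qed.

Lemma ballot_above (R : pzRingType) n : ballot R n n.+1 = - (catalan n)%:R.
Proof.
rewrite /ballot addnS addnn.
have e : ('C(n.*2.+1, n.+1) + catalan n = 2 * 'C(n.*2, n))%N.
  have := mul_bin_diag n.*2.+1 n; rewrite /= -catalan_bin => h.
  by apply/eqP; rewrite -(eqn_pmul2l (ltn0Sn n)); apply/eqP; clear -h; nia.
apply/eqP; rewrite subr_eq -(natrM _ 2) -e natrD addrC addrK //.
Qed.

(** This is the recurrence of the counts themselves. Write T(n) for the n-th sum. Summing Pascal's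
    rule against 2^k gives T(n+1) = T(n) - 2^(n+1) C_n + 2 T(n+1), since the diagonal entry of row
    n+1 vanishes and the entry of row n just above the diagonal is -C_n. *)
Lemma ballot_sum_succ (R : comPzRingType) n :
  \sum_(0 <= k < n.+2) ballot R n.+1 k * 2 ^+ k + \sum_(0 <= k < n.+1) ballot R n k * 2 ^+ k
  = 2 ^+ n.+1 * (catalan n)%:R.
Proof.
have b0 m : ballot R m 0 = 1 by rewrite /ballot bin0 mulr0 subr0.
have e : \sum_(0 <= k < n.+2) ballot R n.+1 k * 2 ^+ k =
    \sum_(0 <= k < n.+2) ballot R n k * 2 ^+ k +
    2 * \sum_(0 <= k < n.+1) ballot R n.+1 k * 2 ^+ k.
  rewrite big_nat_recl // [in RHS]big_nat_recl // !b0 -addrA mulr_sumr -big_split /=.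
  by congr (_ + _); apply: eq_bigr => k _; rewrite ballot_pascal exprS; ring.
have e1 : \sum_(0 <= k < n.+2) ballot R n.+1 k * 2 ^+ k =
    \sum_(0 <= k < n.+1) ballot R n.+1 k * 2 ^+ k.
  by rewrite big_nat_recr //= ballot_diag mul0r addr0.
have e2 : \sum_(0 <= k < n.+2) ballot R n k * 2 ^+ k =
    \sum_(0 <= k < n.+1) ballot R n k * 2 ^+ k - 2 ^+ n.+1 * (catalan n)%:R.
  by rewrite big_nat_recr //= ballot_above; ring.
move: e; rewrite e2 -e1; move: (\sum_(0 <= k < n.+2) _) (\sum_(0 <= k < n.+1) _) => x y.
move=> /(congr1 (fun z => z - x)); rewrite subrr => h.
have -> : x + y = (y - 2 ^+ n.+1 * (catalan n)%:R + 2 * x - x) + 2 ^+ n.+1 * (catalan n)%:R.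
  by ring.
by rewrite -h add0r.
Qed.

Lemma ballotE (R : numFieldType) n k : (k < n)%N ->
  (n - k)%:R / (n + k)%:R * 'C(n + k, n)%:R = ballot R n k.
Proof.
move=> kn; have nz : (n + k)%:R != 0 :> R by rewrite pnatr_eq0; lia.
apply: (mulfI nz); rewrite mulrA mulrCA mulfV // mulr1.
rewrite -[in LHS]bin_sub ?leq_addr // addKn /ballot natrB; last exact: ltnW.
case: k kn {nz} => [|k] kn; first by rewrite addn0 mulr0 !subr0.
have := mul_bin_diag (n + k.+1) k; rewrite [(n + k.+1).-1](_ : _ = n + k)%N; last by rewrite addnS.
move=> /(congr1 (fun m => m%:R : R)); rewrite !natrM => h.
by rewrite [in RHS]mulrBr [_ * (2 * _)]mulrCA h natrD; ring.
Qed.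

(** * Coefficients of sequences satisfying the recursions *)

Section GeneratingFunctions.
Variables d p s : nat -> nat.
Hypothesis d0 : d 0 = 1%N.
Hypothesis d_ps : forall n, d n = ((n == 0) + p n + s n)%N.
Hypothesis d_pd : forall n, d n = ((n == 0) + \sum_(0 <= k < n.+1) p k * d (n - k))%N.
Hypothesis p_ds : forall n, p n =
  (\sum_(0 <= k < n.+1) (d (n - k) - (n - k == 0)) * s k +
   \sum_(0 <= k < n) d (n.-1 - k) * d k)%N.

Definition trunc_gf (R : nzRingType) N (f : nat -> nat) : {poly R} := \poly_(i < N) (f i)%:R.

Lemma coef_trunc_gf (R : nzRingType) N f i : (i < N)%N -> (trunc_gf R N f)`_i = (f i)%:R.
Proof. by move=> iN; rewrite coef_poly iN. Qed.

Lemma coefM_trunc_gf (R : nzRingType) N f g i : (i < N)%N ->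
  (trunc_gf R N f * trunc_gf R N g)`_i = (\sum_(0 <= k < i.+1) f k * g (i - k))%N%:R.
Proof.
move=> iN; rewrite coefM big_mkord natr_sum; apply: eq_bigr => j _.
rewrite natrM !coef_trunc_gf //; first by apply: leq_ltn_trans iN; exact: leq_subr.
by apply: leq_trans iN; exact: ltn_ord.
Qed.

Lemma gf_d_mod (R : comNzRingType) N : exists a : {poly R},
  trunc_gf R N d = (1 + trunc_gf R N p * trunc_gf R N d) + 'X^N * a.
Proof.
apply: eq_coef_mod => i iN.
by rewrite coefD coef1 coefM_trunc_gf // coef_trunc_gf // d_pd natrD.
Qed.

Lemma gf_p_mod (R : comNzRingType) N : exists h : {poly R},
  trunc_gf R N p = 'X + 2%:R * trunc_gf R N p ^+ 2 + 'X^N * h.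
Proof.
have [a Ea] := gf_d_mod R N.
set P := trunc_gf R N p in Ea *; set D := trunc_gf R N d in Ea *; set S := trunc_gf R N s.
have [b Eb] : exists b, D = (1 + P + S) + 'X^N * b.
  by apply: eq_coef_mod => i iN; rewrite !coefD coef1 !coef_trunc_gf // d_ps !natrD.
have [c Ec] : exists c, P = ((D - 1) * S + 'X * (D * D)) + 'X^N * c.
  apply: eq_coef_mod => i iN; rewrite coefD coefXM coef_trunc_gf // p_ds natrD; congr (_ + _).
    have -> : D - 1 = trunc_gf R N (fun n => d n - (n == 0))%N.
      apply/polyP => j; rewrite coefB coef1 !coef_poly.
      case: ifP => jN; last first.
        by rewrite (_ : (j == 0) = false) ?subr0 //; case: j jN => //; rewrite (leq_ltn_trans _ iN).
      by rewrite natrB //; case: j {jN} => // ; rewrite d0.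
    rewrite mulrC coefM_trunc_gf //; congr (_%:R); apply: eq_bigr => k _; exact: mulnC.
  case: i iN => [|i] iN; first by rewrite big_geq.
  rewrite /= coefM_trunc_gf //; last exact: ltnW.
  congr (_%:R); apply: eq_bigr => k _; exact: mulnC.
exact: skew_equation_mod Ea Eb Ec.
Qed.

Lemma p_conv n : p n = ((n == 1) + 2 * \sum_(0 <= k < n.+1) p k * p (n - k))%N.
Proof.
have [h E] := gf_p_mod int n.+1.
have /(congr1 (fun f : {poly int} => f`_n)) := E.
rewrite /= [2%:R * _]mulr_natl coefD [('X + _)`_n]coefD coefX coefMn expr2.
rewrite coefM_trunc_gf // coef_trunc_gf // coefXnM ltnSn.
by rewrite addr0 -mulrnA -natrD => /eqP; rewrite eqr_nat mulnC => /eqP.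
Qed.

Lemma p0 : p 0 = 0%N.
(* The natural number p(0) satisfies p(0) = 2 p(0)^2, which forces 0. *)
Proof. by have := p_conv 0; rewrite big_nat1 subnn /=; nia. Qed.

Lemma p1 : p 1 = 1%N.
Proof. by have := p_conv 1; rewrite big_nat_recr //= big_nat1 subnn subn0 p0 muln0. Qed.

Lemma d_succ n : (d n.+1 + d n = 2 * p n.+1)%N.
Proof.
have [a Ea] := gf_d_mod int n.+2; have [h Eh] := gf_p_mod int n.+2.
have [k E] := dumont_equation_mod Ea Eh.
have /(congr1 (fun f : {poly int} => f`_n.+1)) := E.
rewrite /= !coefD coefXM coef1 /= [2%:R * _]mulr_natl coefMn !coef_trunc_gf //= coefXnM ltnSn.
by rewrite addr0 add0r -mulrnA -natrD => /eqP; rewrite eqr_nat mulnC => /eqP.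
Qed.

(* Differentiating P = X + 2P^2 and using (1 - 4P)^2 = 1 - 8X gives
   (1 - 8X) P' = 1 - 4P. *)
Lemma p_succ n : (n.+2 * p n.+2 = 4 * (2 * n).+1 * p n.+1)%N.
Proof.
(* Differentiation lowers the order of the remainder to n + 2, still beyond the coefficient n + 1
   that is compared below. *)
have [h Eh] := gf_p_mod int n.+3; set P := trunc_gf int n.+3 p in Eh.
have EP i : (i < n.+3)%N -> P`_i = (p i)%:R by exact: coef_trunc_gf.
clearbody P; set m : {poly int} := 'X^(n.+2); set m' : {poly int} := 'X^(n.+3) in Eh.
pose g : {poly int} := n.+3%:R * h + 'X * h^`().
have Em : m' = 'X * m by rewrite /m' exprS.
have dm : m'^`() = n.+3%:R * m by rewrite derivXn mulr_natl.
have EdP : P^`() = 1 + 4%:R * P * P^`() + m * g.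
  have E2 : P = 'X + (P * P + P * P) + m' * h by rewrite {1}Eh; ring.
  clearbody m' m; rewrite {1}E2 !derivD derivX !derivM dm /g Em.
  by ring.
clearbody m'.
have E2 : P^`() - 8%:R * ('X * P^`()) =
    1 - 4%:R * P + m * (g * (1 - 4%:R * P) + 8%:R * 'X * h * P^`()).
  have z1 : P - ('X + 2%:R * P ^+ 2 + 'X * m * h) = 0.
    by apply/eqP; rewrite subr_eq0 -Em; apply/eqP.
  have z2 : P^`() - (1 + 4%:R * P * P^`() + m * g) = 0.
    by apply/eqP; rewrite subr_eq0; apply/eqP.
  clearbody g m; clear Em Eh EdP; apply/eqP; rewrite -subr_eq0; apply/eqP.
  transitivity ((1 - 4%:R * P) * (P^`() - (1 + 4%:R * P * P^`() + m * g))
    + 8%:R * P^`() * (P - ('X + 2%:R * P ^+ 2 + 'X * m * h))); first by ring.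
  by rewrite z1 z2 !mulr0 addr0.
have /(congr1 (fun f : {poly int} => f`_n.+1)) /= := E2.
rewrite !coefD !coefN coef1 !mulr_natl !coefMn coefXM !coef_deriv /= coefXnM ltnSn.
rewrite !EP // addr0 sub0r => /eqP; rewrite subr_eq addrC eq_sym subr_eq -!mulrnA -natrD.
by rewrite eqr_nat => /eqP; clear; nia.
Qed.

(** Both sides obey the same first-order recurrence, by [p_succ] and [central_bin_succ]. *)
Lemma p_central n : (n.+1 * p n.+1 = 2 ^ n * 'C(n.*2, n))%N.
Proof.
elim: n => [|n IH]; first by rewrite p1.
apply/eqP; rewrite -(eqn_pmul2l (ltn0Sn n)); apply/eqP.
have := central_bin_succ n; have := p_succ n; rewrite expnS.
move: IH; move: ('C(n.+1.*2, n.+1)) ('C(n.*2, n)) (2 ^ n)%N (p n.+1) (p n.+2) => c c' t x y.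
clear=> h1 h2 h3; have -> : (n.+1 * (n.+2 * y) = 4 * (2 * n).+1 * (n.+1 * x))%N by nia.
by rewrite h1; nia.
Qed.

Lemma p_catalan n : p n.+1 = (2 ^ n * catalan n)%N.
Proof.
apply/eqP; rewrite -(eqn_pmul2l (ltn0Sn n)) p_central mulnCA; apply/eqP; congr muln.
by rewrite mulnC catalan_bin.
Qed.

Lemma d_succ_catalan (R : pzRingType) n :
  (d n.+1)%:R + (d n)%:R = 2 ^+ n.+1 * (catalan n)%:R :> R.
Proof. by rewrite -natrD d_succ p_catalan mulnA -expnS natrM natrX. Qed.

Lemma d_alternating (R : comPzRingType) n : (d n)%:R =
  (-1) ^+ n + \sum_(1 <= k < n.+1) (-1) ^+ (n - k) * 2 ^+ k * (catalan k.-1)%:R :> R.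
Proof.
elim: n => [|n IH]; first by rewrite d0 big_geq // addr0.
apply: (addIr (d n)%:R); rewrite d_succ_catalan {}IH big_nat_recr //= subnn expr0 mul1r.
have -> : \sum_(1 <= k < n.+1) (-1) ^+ (n.+1 - k) * 2 ^+ k * (catalan k.-1)%:R =
   - \sum_(1 <= k < n.+1) (-1) ^+ (n - k) * 2 ^+ k * (catalan k.-1)%:R :> R.
  rewrite -sumrN; apply: eq_big_nat => k /andP[_ kn].
  by rewrite subSn // exprS; ring.
rewrite [(-1) ^+ n.+1]exprS; move: (\sum_(1 <= k < _) _) (2 ^+ n.+1) ((-1) ^+ n) => u v w.
by ring.
Qed.

Lemma d_ballot (R : comPzRingType) n :
  (d n)%:R = \sum_(0 <= k < n.+1) ballot R n k * 2 ^+ k.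
Proof.
elim: n => [|n IH]; first by rewrite d0 big_nat1 ballot_diag mulr1.
by apply: (addIr (d n)%:R); rewrite d_succ_catalan [in RHS]IH ballot_sum_succ.
Qed.

Lemma d_ballot_quotient (R : numFieldType) n : (d n)%:R =
  \sum_(0 <= k < n) ((n - k)%:R / (n + k)%:R) * ('C(n + k, n))%:R * 2 ^+ k
  + (n == 0%N)%:R :> R.
Proof.
rewrite d_ballot big_nat_recr //= ballot_diag; congr (_ + _).
  by apply: eq_big_nat => k /andP[_ kn]; rewrite ballotE.
by case: n => [|n]; rewrite ?mulr1 ?mul0r.
Qed.

(** * Estimates up to the singularity 1/8 *)

Section Estimates.
Variable R : realFieldType.
Implicit Types x t : R.

(* The remainder 2 N p_N / 8^N makes this a telescoping sum. *)
Lemma sum_p_eighth n : \sum_(i < n.+1) (p i)%:R / 8 ^+ i +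
  2 * (n.+1 * p n.+1)%:R / 8 ^+ n.+1 = 1 / 4 :> R.
Proof.
elim: n => [|n IH].
  by rewrite big_ord1 p0 p1 mul0r add0r expr1 mul1n; lra.
rewrite -IH big_ord_recr /= -addrA; congr (_ + _).
have -> : (n.+2 * p n.+2)%:R = 4 * (2 * n%:R + 1) * (p n.+1)%:R :> R.
  by rewrite p_succ !natrM -[(2 * n).+1%:R]natr1 natrM.
rewrite natrM [8 ^+ n.+2]exprS -[n.+1%:R]natr1; move: (p n.+1)%:R => a.
have : 8 ^+ n.+1 != 0 :> R by rewrite expf_neq0 // pnatr_eq0.
by move: (8 ^+ n.+1) => z z0; field.
Qed.

(** The bound 1/4 is the double root of 2P^2 - P + 1/8. *)
Lemma sum_p_eighth_le n : \sum_(i < n) (p i)%:R / 8 ^+ i <= 1 / 4 :> R.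
Proof.
case: n => [|n]; first by rewrite big_ord0; lra.
by rewrite -(sum_p_eighth n) lerDl divr_ge0 ?exprn_ge0 ?mulr_ge0 ?ler0n.
Qed.

Lemma p_eighth_le n : (p n)%:R / 8 ^+ n <= 1 / 4 :> R.
Proof.
apply: le_trans (sum_p_eighth_le n.+1); rewrite big_ord_recr /= lerDr.
by apply: sumr_ge0 => i _; rewrite divr_ge0 ?exprn_ge0 ?ler0n.
Qed.

Lemma p_term x n : (p n)%:R * `|x| ^+ n = (p n)%:R / 8 ^+ n * (8 * `|x|) ^+ n.
Proof.
have z0 : 8 ^+ n != 0 :> R by rewrite expf_neq0 // pnatr_eq0.
by rewrite exprMn -mulrA mulKf.
Qed.

Lemma horner_trunc_gf N f x : (trunc_gf R N f).[x] = \sum_(i < N) (f i)%:R * x ^+ i.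
Proof. exact: horner_poly. Qed.

Lemma trunc_gf_p_le N x : `|x| <= 1 / 8 -> (trunc_gf R N p).[x] <= 1 / 4.
Proof.
move=> hx; rewrite horner_trunc_gf; apply: le_trans (sum_p_eighth_le N).
apply: ler_sum => i _; apply: le_trans (ler_norm _) _.
rewrite normrM normrX normr_nat p_term ler_piMr ?divr_ge0 ?exprn_ge0 ?ler0n //.
by rewrite exprn_ile1 ?mulr_ge0 //; lra.
Qed.

(* The coefficients of 2 P_N^2 - P_N + X vanish below degree N, and the i-th one is
   between 0 and p_i otherwise. *)
Lemma trunc_gf_residual N x : (1 < N)%N -> `|x| <= 1 / 8 ->
  `|2 * (trunc_gf R N p).[x] ^+ 2 - (trunc_gf R N p).[x] + x| <= (8 * `|x|) ^+ N / 4.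
Proof.
move=> N1 hx; set P := trunc_gf R N p; pose E := 2%:R * (P * P) - P + 'X.
have -> : 2 * P.[x] ^+ 2 - P.[x] + x = E.[x].
  by rewrite /E !hornerE; ring.
have P_ge0 i : 0 <= P`_i by rewrite coef_poly; case: ifP.
have P_le i : P`_i <= (p i)%:R by rewrite coef_poly; case: ifP.
have conv i : 2 * \sum_(j < i.+1) (p j)%:R * (p (i - j))%:R = (p i)%:R - (i == 1%N)%:R :> R.
  rewrite [in RHS]p_conv big_mkord natrD natrM natr_sum addrC addKr; congr (_ * _).
  by apply: eq_bigr => j _; rewrite natrM.
have coefE i : E`_i = 2 * \sum_(j < i.+1) P`_j * P`_(i - j) - P`_i + (i == 1%N)%:R.
  by rewrite /E !coefD coefN coefX mulr_natl coefMn coefM mulr_natl.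
have Ecoef i : 0 <= E`_i <= (N <= i)%:R * (p i)%:R.
  rewrite coefE; have [iN|iN] := ltnP i N.
    rewrite mul0r [X in 2 * X](_ : _ = \sum_(j < i.+1) (p j)%:R * (p (i - j))%:R).
      by rewrite conv coef_trunc_gf // addrAC subrK subrr lexx.
    apply: eq_bigr => j _; rewrite !coef_trunc_gf //.
      by apply: leq_ltn_trans iN; exact: leq_subr.
    by apply: leq_trans iN; exact: ltn_ord.
  have -> : P`_i = 0 by rewrite coef_poly ltnNge iN.
  rewrite gtn_eqF ?(leq_trans N1) // subr0 addr0 mul1r.
  apply/andP; split.
    by rewrite mulr_ge0 // sumr_ge0 // => j _; rewrite mulr_ge0.
  have := conv i; rewrite gtn_eqF ?(leq_trans N1) // subr0 => <-.
  by rewrite ler_wpM2l // ler_sum // => j _; rewrite ler_pM.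
rewrite horner_coef; apply: le_trans (ler_norm_sum _ _ _) _.
(* Only degrees i >= N contribute, and there (8|x|)^i <= (8|x|)^N; the remaining weights p(i) / 8^i
   sum to at most 1/4. *)
apply: (@le_trans _ _ (\sum_(i < size E) (p i)%:R / 8 ^+ i * (8 * `|x|) ^+ N)); last first.
  rewrite -mulr_suml mulrC -[_ / 4]mulr1 -mulrA ler_wpM2l ?exprn_ge0 ?mulr_ge0 //.
  by have := sum_p_eighth_le (size E); rewrite mulr1 div1r.
apply: ler_sum => i _; have /andP[E0 E1] := Ecoef i.
rewrite normrM normrX (ger0_norm E0).
apply: le_trans (ler_wpM2r (exprn_ge0 _ (normr_ge0 x)) E1) _.
have [Ni|Ni] := leqP N i; last first.
  by rewrite !mul0r mulr_ge0 ?divr_ge0 ?exprn_ge0 ?ler0n ?mulr_ge0.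
rewrite mul1r p_term ler_wpM2l ?divr_ge0 ?exprn_ge0 ?ler0n //.
by rewrite ler_wiXn2l ?mulr_ge0 //; lra.
Qed.

(** By [d_succ] everything cancels except the top term d(N) x^(N+1), and d(N) <= 2 p(N+1) <= 8^(N+1)
    / 2. *)
Lemma trunc_gf_d N x : `|x| <= 1 / 8 ->
  `|(1 + x) * (trunc_gf R N.+1 d).[x] - (1 + 2 * (trunc_gf R N.+1 p).[x])|
    <= (8 * `|x|) ^+ N.+1.
Proof.
move=> hx.
have -> : (1 + x) * (trunc_gf R N.+1 d).[x] - (1 + 2 * (trunc_gf R N.+1 p).[x]) =
   (d N)%:R * x ^+ N.+1.
  rewrite !horner_trunc_gf; elim: N => [|N IH].
    by rewrite !big_ord1 d0 p0; ring.
  rewrite big_ord_recr [in X in _ - X]big_ord_recr /=.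
  set u := \sum_(i < N.+1) _ in IH *; set v := \sum_(i < N.+1) _ in IH *.
  have := d_succ N => /(congr1 (fun n => n%:R : R)); rewrite natrD natrM => h.
  transitivity ((1 + x) * u - (1 + 2 * v) +
     ((1 + x) * (d N.+1)%:R - 2 * (p N.+1)%:R) * x ^+ N.+1); first by ring.
  by rewrite IH -h [x ^+ N.+2]exprS; ring.
have dp : (d N)%:R <= 2 * (p N.+1)%:R :> R.
  by rewrite -natrM ler_nat -d_succ leq_addl.
rewrite normrM normrX normr_nat.
apply: le_trans (ler_wpM2r (exprn_ge0 _ (normr_ge0 x)) dp) _.
rewrite -mulrA p_term mulrA ler_piMl ?exprn_ge0 ?mulr_ge0 //.
have := p_eighth_le N.+1; lra.
Qed.
End Estimates.

(** * Convergence and closed forms *)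

Lemma cvg_geometric_bound (R : realType) (u : R^nat) (l q : R) : `|q| < 1 ->
  (\forall n \near \oo, `|u n - l| <= q ^+ n) -> u @ \oo --> l.
Proof.
move=> q1 uq.
have near0 : \forall n \near \oo, 0 <= `|u n - l| <= q ^+ n.
  by near=> n; rewrite normr_ge0 /=; near: n.
apply/subr_cvg0; apply: norm_cvg0.
exact: (squeeze_cvgr near0 (cvg_cst _) (cvg_expr q1)).
Unshelve. all: by end_near.
Qed.

(** Put S = 1 - 4P for the truncated P. The residual estimate makes S^2 converge to 1 - 8x; as P <=
    1/4 gives S >= 0, S is the square root of S^2 and continuity of the root applies. *)
Lemma cvg_gf_p (R : realType) (x : R) : `|x| < 1 / 8 ->
  (fun N => (trunc_gf R N p).[x]) @ \oo --> (1 - Num.sqrt (1 - 8 * x)) / 4.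
Proof.
move=> hx; have hx' := ltW hx.
have q1 : `|8 * `|x| | < 1 by rewrite normrM normr_id normr_nat; lra.
pose S N := 1 - 4 * (trunc_gf R N p).[x].
have SE N : Num.sqrt (S N ^+ 2) = S N.
  by rewrite sqrtr_sqr ger0_norm // /S; have := trunc_gf_p_le N hx'; lra.
have cS2 : (fun N => S N ^+ 2) @ \oo --> 1 - 8 * x.
  have c2 : (fun N => 2 * (8 * `|x|) ^+ N) @ \oo --> (0 : R).
    by rewrite -[0](mulr0 2); apply: cvgMl_tmp; apply: cvg_expr.
  have near0 : \forall N \near \oo, 0 <= `|S N ^+ 2 - (1 - 8 * x)| <= 2 * (8 * `|x|) ^+ N.
    exists 2%N => // N N1; rewrite normr_ge0 /=.
    have -> : S N ^+ 2 - (1 - 8 * x) =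
        8 * (2 * (trunc_gf R N p).[x] ^+ 2 - (trunc_gf R N p).[x] + x) by rewrite /S; ring.
    by rewrite normrM normr_nat; have := trunc_gf_residual N1 hx'; lra.
  apply/subr_cvg0; apply: norm_cvg0.
  exact: (squeeze_cvgr near0 (cvg_cst _) c2).
have cS : S @ \oo --> Num.sqrt (1 - 8 * x).
  have -> : S = (fun N => Num.sqrt (S N ^+ 2)) by apply/funext => N; rewrite SE.
  by apply: continuous_cvg => //; exact: sqrt_continuous.
have -> : (fun N => (trunc_gf R N p).[x]) = (fun N => (1 - S N) / 4).
  by apply/funext => N; rewrite /S; field.
by apply: cvgMr_tmp; apply: cvgB => //; exact: cvg_cst.
Qed.

Lemma cvg_gf_d (R : realType) (x : R) : `|x| < 1 / 8 ->
  series (fun n => (d n)%:R * x ^+ n) @ \oo --> (3 - Num.sqrt (1 - 8 * x)) / (2 * (1 + x)).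
Proof.
move=> hx; have hx' := ltW hx.
have x1 : 1 + x != 0 by move: hx; rewrite ltr_norml => /andP[? ?]; rewrite gt_eqF //; lra.
have q1 : `|8 * `|x| | < 1 by rewrite normrM normr_id normr_nat; lra.
have cP := cvg_gf_p hx.
have cr : (fun N => (1 + x) * (trunc_gf R N d).[x] - (1 + 2 * (trunc_gf R N p).[x])) 
    @ \oo --> 0.
  apply: cvg_geometric_bound q1 _; exists 1%N => // -[|N] // _ /=.
  by rewrite subr0; apply: trunc_gf_d.
have -> : series (fun n => (d n)%:R * x ^+ n) =
   (fun N => (((1 + x) * (trunc_gf R N d).[x] - (1 + 2 * (trunc_gf R N p).[x]))
      + (1 + 2 * (trunc_gf R N p).[x])) * (1 + x)^-1).
  apply/funext => N; rewrite subrK mulrAC mulfV // mul1r horner_trunc_gf.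
  by rewrite /series /= big_mkord.
have -> : (3 - Num.sqrt (1 - 8 * x)) / (2 * (1 + x)) =
    (0 + (1 + 2 * ((1 - Num.sqrt (1 - 8 * x)) / 4))) * (1 + x)^-1.
  by field.
apply: cvgMr_tmp; apply: cvgD => //; apply: cvgD; first exact: cvg_cst.
exact: cvgMl_tmp.
Qed.

End GeneratingFunctions.

(** Everything rests on x C(2x) = (1 - r) / 4 with r^2 = 1 - 8x, where x = 0 is checked apart
    because of the case distinction in [Cgf]. The factor 2/3 can be checked at x = 0, where F = 1
    and C(2/9) = 3/2. *)
Lemma gf_closed_forms (R : realType) (x : R) : `|x| < 1 / 8 ->
  let F := (3 - Num.sqrt (1 - 8 * x)) / (2 * (1 + x)) in
  [/\ F = 2 / 3 * Cgf (2 * (1 + x) / 9),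
      F = (1 + 2 * x * Cgf (2 * x)) / (1 + x) &
      F = 1 / (1 - x * Cgf (2 * x))].
Proof.
rewrite ltr_norml => /andP[x1 x2] F; rewrite /F {F}.
have x10 : 1 + x != 0 by rewrite gt_eqF //; lra.
set r := Num.sqrt (1 - 8 * x).
have r0 : 0 <= r by exact: sqrtr_ge0.
have r2 : r ^+ 2 = 1 - 8 * x by rewrite sqr_sqrtr //; lra.
have xC : x * Cgf (2 * x) = (1 - r) / 4.
  rewrite /Cgf; have [x0|x0] := eqVneq x 0.
    by rewrite x0 mul0r /r x0 mulr0 subr0 sqrtr1 subrr mul0r.
  rewrite mulf_eq0 (negbTE x0) pnatr_eq0 /=.
  have -> : 1 - 4 * (2 * x) = 1 - 8 * x by ring.
  by rewrite -/r; field.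
split.
- rewrite /Cgf.
  have -> : (2 * (1 + x) / 9 == 0) = false.
    by apply/negbTE; rewrite !mulf_neq0 ?invr_eq0 ?pnatr_eq0.
  have -> : 1 - 4 * (2 * (1 + x) / 9) = (r / 3) ^+ 2 by rewrite expr_div_n r2; field.
  rewrite sqrtr_sqr ger0_norm; last by rewrite divr_ge0.
  by field.
- rewrite -mulrA xC; field; exact: x10.
rewrite xC.
have r3 : 3 + r != 0 by rewrite gt_eqF //; lra.
(* Since 1 - x C(2x) = (3 + r) / 4, the last form is the first one with its numerator 3 - r
   rationalised. *)
have r9 : (3 + r) * (3 - r) = 8 * (1 + x).
  by transitivity (9 - r ^+ 2); [ring|rewrite r2; ring].
apply/eqP; rewrite eqr_div ?mulf_neq0 ?pnatr_eq0 //; last by rewrite gt_eqF //; lra.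
apply/eqP; transitivity ((3 + r) * (3 - r) / 4); first by field.
by rewrite r9; field.
Qed.

Unset Implicit Arguments.

Theorem theorem3p11 (R : realType) :
  (forall x : R, `|x| < 1 / 8 ->
     let F := (3 - Num.sqrt (1 - 8 * x)) / (2 * (1 + x)) in
     series (fun n : nat => (D1_2413_3142 n)%:R * x ^+ n) @ \oo --> F
     /\ F = 2 / 3 * Cgf (2 * (1 + x) / 9)
     /\ F = (1 + 2 * x * Cgf (2 * x)) / (1 + x)
     /\ F = 1 / (1 - x * Cgf (2 * x)))
  /\
  (forall n : nat,
     (D1_2413_3142 n)%:R
       = (-1) ^+ n + \sum_(1 <= k < n.+1) (-1) ^+ (n - k) * 2 ^+ k * (catalan k.-1)%:R :> R
     /\ (D1_2413_3142 n)%:R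
       = \sum_(0 <= k < n) ((n - k)%:R / (n + k)%:R) * ('C(n + k, n))%:R * 2 ^+ k
         + (n == 0%N)%:R :> R).
Proof.
pose d n := size (dumont_words n); pose p n := size (skew_sums n).
pose s n := size (direct_sums n).
have dE n : D1_2413_3142 n = d n := D1_size n.
have d0 : d 0%N = 1%N := size_dumont_words0.
have d_ps n : d n = ((n == 0) + p n + s n)%N := size_dumont_words n.
have d_pd n := dumont_words_rec n : d n = _.
have p_ds n := skew_sums_rec n : p n = _.
split=> [x hx F|n].
  have [e1 e2 e3] := gf_closed_forms hx; split=> //.
  under [X in series X]eq_fun do rewrite dE.
  exact: (cvg_gf_d d0 d_ps d_pd p_ds).
rewrite dE; split; first exact: (d_alternating d0 d_ps d_pd p_ds).
exact: (d_ballot_quotient d0 d_ps d_pd p_ds).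
Qed.
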